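(* Let $Y=Y_\hbar(\mathfrak{sl}_2)$. The element $\mathcal R^-(s)\in Y^{\otimes2}[[s^{-1}]]$ is given by $$\mathcal R^-(s)=1^{\otimes2}+\sum_{n\ge1}\ \sum_{\substack{k_1,\ldots,k_r\in\mathbb Z_{\ge1}\\k_1+\cdots+k_r=n}}\frac1{k_1(k_1+k_2)\cdots(k_1+\cdots+k_r)}\,\omega(s)_{k_1}\cdots\omega(s)_{k_r},$$ where $$\omega(s)_k=\frac{(-1)^k}{k\hbar}\oint x^-(u-s)^k\otimes x^+(u)^k\,du.$$
   Context: Fix $\hbar\in\mathbb C^\times$. $Y=Y_\hbar(\mathfrak{sl}_2)$ is the unital associative algebra generated by $\{\xi_r,x_r^\pm\}_{r\ge0}$ with relations, for $r,s\ge0$: $[\xi_r,\xi_s]=0$; $[\xi_0,x_s^\pm]=\pm2x_s^\pm$; $[\xi_{r+1},x_s^\pm]-[\xi_r,x_{s+1}^\pm]=\pm\hbar(\xi_rx_s^\pm+x_s^\pm\xi_r)$; $[x_{r+1}^\pm,x_s^\pm]-[x_r^\pm,x_{s+1}^\pm]=\pm\hbar(x_r^\pm x_s^\pm+x_s^\pm x_r^\pm)$; $[x_r^+,x_s^-]=\xi_{r+s}$. Put $x^\pm(u)=\hbar\sum_{r\ge0}x_r^\pm u^{-r-1}$ and $t_1=\xi_1-\frac\hbar2\xi_0^2$. $Y_{n\alpha}=\{y\in Y:[\xi_0,y]=2ny\}$. $\mathcal R^-(s)$ is the unique element of the form $\sum_{n\ge0}\mathcal R^-_{n\alpha}(s)\in(Y\otimes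 Y)[[s^{-1}]]$ with $\mathcal R^-_{n\alpha}(s)\in(Y_{-n\alpha}\otimes Y_{n\alpha})[[s^{-1}]]$, $\mathcal R^-_0(s)=1\otimes1$, and $$\mathcal R^-(s)\cdot\big(t_1\otimes1+1\otimes t_1+s\,\xi_0\otimes1-2\hbar\,x_0^-\otimes x_0^+\big)=\big(t_1\otimes1+1\otimes t_1+s\,\xi_0\otimes1\big)\cdot\mathcal R^-(s).$$ (The existence and uniqueness of this element is known; the two bracketed elements are the standard and Drinfeld deformed coproducts of $t_1$.) $\oint-\,du$ is the formal residue, i.e. the coefficient of $u^{-1}$ of a Laurent series in $u^{-1}$; $x^-(u-s)$ is expanded in $Y[u][[s^{-1}]]$. The inner sum is over all compositions $(k_1,\dots,k_r)$ of $n$, of any length $r\ge1$. *)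

(* Defs.v *)
From HB Require Import structures.
From mathcomp Require Import all_boot all_order all_algebra.
From mathcomp Require Import finmap.
From mathcomp Require Import boolp classical_sets functions cardinality fsbigop.
From mathcomp Require Import reals complex.
From mathcomp Require Import monalg zify.

Set Implicit Arguments.
Unset Strict Implicit.
Unset Printing Implicit Defensive.

Import Order.TTheory GRing.Theory Num.Theory.

Local Open Scope classical_set_scope.
Local Open Scope ring_scope.

Section SpanQuotient.
Variables (K : fieldType) (V : lmodType K) (S : set V).

Inductive in_span : V -> Prop :=
| in_span0 : in_span 0
| in_spanD c v w : S v -> in_span w -> in_span (c *: v + w).

Lemma in_spanDD v w : in_span v -> in_span w -> in_span (v + w).
Proof.
elim=> [|c u x Su _ IH] hw; first by rewrite add0r.
by rewrite -addrA; apply: in_spanD => //; apply: IH.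
Qed.

Lemma in_spanZ a v : in_span v -> in_span (a *: v).
Proof.
elim=> [|c u x Su _ IH]; first by rewrite scaler0; exact: in_span0.
by rewrite scalerDr scalerA; apply: in_spanD.
Qed.

Lemma in_span_gen v : S v -> in_span v.
Proof.
by move=> Sv; rewrite -[v]addr0 -[v]scale1r; apply: in_spanD => //; exact: in_span0.
Qed.

Definition spanb : {pred V} := fun v => `[< in_span v >].

Lemma spanP v : reflect (in_span v) (v \in spanb).
Proof. exact: asboolP. Qed.

Lemma span_zmod_closed : zmod_closed spanb.
Proof.
split=> [|v w /spanP hv /spanP hw]; first by apply/spanP; exact: in_span0.
by apply/spanP; rewrite -scaleN1r; apply: in_spanDD => //; exact: in_spanZ.
Qed.
HB.instance Definition _ := GRing.isZmodClosed.Build V spanb span_zmod_closed.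

Definition span_quot : Type := Quotient.quot spanb.
HB.instance Definition _ := GRing.Zmodule.on span_quot.

Definition qpi (v : V) : span_quot := (\pi_(Quotient.quot spanb) v)%qT.

Lemma qpi_eq v w : qpi v = qpi w <-> in_span (v - w).
Proof.
split=> [h|h]; first by apply/spanP; rewrite Quotient.idealrBE; apply/eqP.
by apply/eqP; rewrite -Quotient.idealrBE; apply/spanP.
Qed.

Lemma qpi_zmod : zmod_morphism qpi.
Proof. by move=> v w; rewrite /qpi !piE. Qed.
HB.instance Definition _ := GRing.isZmodMorphism.Build V span_quot qpi qpi_zmod.

Definition qrepr (x : span_quot) : V := repr (x : Quotient.quot spanb).
Lemma qreprK x : qpi (qrepr x) = x. Proof. exact: reprK. Qed.

Definition qscale a (x : span_quot) : span_quot := qpi (a *: qrepr x).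

Lemma qscaleE a v : qscale a (qpi v) = qpi (a *: v).
Proof.
apply/qpi_eq; rewrite -scalerBr; apply/in_spanZ/qpi_eq; exact: qreprK.
Qed.

Lemma qscaleA a b x : qscale a (qscale b x) = qscale (a * b) x.
Proof. by rewrite -[x]qreprK !qscaleE scalerA. Qed.
Lemma qscale1 : left_id 1 qscale.
Proof. by move=> x; rewrite -[x]qreprK qscaleE scale1r. Qed.
Lemma qscaleDr : right_distributive qscale +%R.
Proof.
move=> a x y; rewrite -[x]qreprK -[y]qreprK -raddfD !qscaleE -raddfD /=.
by rewrite scalerDr.
Qed.
Lemma qscaleDl x : {morph qscale^~ x : a b / a + b}.
Proof. by move=> a b; rewrite -[x]qreprK !qscaleE scalerDl raddfD. Qed.
HB.instance Definition _ := GRing.Zmodule_isLmodule.Build K span_quot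
  qscaleA qscale1 qscaleDr qscaleDl.

Lemma qpi_scalable : scalable qpi.
Proof. by move=> a v; rewrite -qscaleE. Qed.
HB.instance Definition _ := GRing.isScalable.Build K V span_quot *:%R qpi
  qpi_scalable.

End SpanQuotient.


Section FreeAlgebra.
Variables (K : fieldType) (I : choiceType).

Definition free_alg : Type := {malg K[{fmonom I}]}.
HB.instance Definition _ := GRing.Lalgebra.on free_alg.

Definition fgen (i : I) : free_alg := << fmu i >>.

Lemma free_scalerAr (a : K) (x y : free_alg) : a *: (x * y) = x * (a *: y).
Proof.
rewrite (malgMEw (fsubset_refl _) (msuppZ_le a y)) malgME scaler_sumr.
apply: eq_bigr => k _; rewrite scaler_sumr; apply: eq_bigr => l _.
rewrite mcoeffZ mulrCA; apply/malgP => m; rewrite [LHS]mcoeffZ.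
by rewrite [X in _ * X = _]mcoeffU [RHS]mcoeffU mulrnAr.
Qed.
HB.instance Definition _ := GRing.Lalgebra_isAlgebra.Build K free_alg
  free_scalerAr.

End FreeAlgebra.

Section Presentation.
Variables (K : fieldType) (F : algType K) (Rel : set F).

(* The two-sided ideal generated by [Rel] is the span of [ideal_gens]. *)
Definition ideal_gens : set F :=
  [set w | exists u r v, Rel r /\ w = u * r * v].

Definition presented_alg : Type := span_quot ideal_gens.
HB.instance Definition _ := GRing.Lmodule.on presented_alg.

Definition ppi : F -> presented_alg := @qpi K F ideal_gens.
HB.instance Definition _ := GRing.Linear.on ppi.

Lemma ideal_mull u x : in_span ideal_gens x -> in_span ideal_gens (u * x).
Proof.
elim=> [|c y z [u' [r [v [Rr ->]]]] _ IH]; first by rewrite mulr0; exact: in_span0.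
rewrite mulrDr -scalerAr; apply: in_spanD => //.
exists (u * u'), r, v; by split=> //; rewrite !mulrA.
Qed.

Lemma ideal_mulr u x : in_span ideal_gens x -> in_span ideal_gens (x * u).
Proof.
elim=> [|c y z [u' [r [v [Rr ->]]]] _ IH]; first by rewrite mul0r; exact: in_span0.
rewrite mulrDl -scalerAl; apply: in_spanD => //.
exists u', r, (v * u); by split=> //; rewrite !mulrA.
Qed.

Definition pmul (x y : presented_alg) : presented_alg :=
  ppi (qrepr x * qrepr y).

Lemma pmulE u v : pmul (ppi u) (ppi v) = ppi (u * v).
Proof.
apply/qpi_eq; set u' := qrepr _; set v' := qrepr _.
have hu : in_span ideal_gens (u' - u) by apply/qpi_eq; exact: qreprK.
have hv : in_span ideal_gens (v' - v) by apply/qpi_eq; exact: qreprK.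
have -> : u' * v' - u * v = u' * (v' - v) + (u' - u) * v.
  by rewrite mulrBr mulrBl addrA addrNK.
apply: in_spanDD; first exact: ideal_mull.
exact: ideal_mulr.
Qed.

Lemma ppi_surj x : exists u, ppi u = x.
Proof. by exists (qrepr x); exact: qreprK. Qed.

Lemma pmulA : associative pmul.
Proof.
move=> x y z.
have [[u <-] [v <-] [w <-]] := And3 (ppi_surj x) (ppi_surj y) (ppi_surj z).
by rewrite !pmulE mulrA.
Qed.
Lemma pmul1l : left_id (ppi 1) pmul.
Proof. by move=> x; have [u <-] := ppi_surj x; rewrite pmulE mul1r. Qed.
Lemma pmul1r : right_id (ppi 1) pmul.
Proof. by move=> x; have [u <-] := ppi_surj x; rewrite pmulE mulr1. Qed.
Lemma pmulDl : left_distributive pmul +%R.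
Proof.
move=> x y z.
have [[u <-] [v <-] [w <-]] := And3 (ppi_surj x) (ppi_surj y) (ppi_surj z).
by rewrite -raddfD !pmulE mulrDl raddfD.
Qed.
Lemma pmulDr : right_distributive pmul +%R.
Proof.
move=> x y z.
have [[u <-] [v <-] [w <-]] := And3 (ppi_surj x) (ppi_surj y) (ppi_surj z).
by rewrite -raddfD !pmulE mulrDr raddfD.
Qed.
HB.instance Definition _ := GRing.Zmodule_isPzRing.Build presented_alg
  pmulA pmul1l pmul1r pmulDl pmulDr.

Lemma ppi_monoid : monoid_morphism ppi.
Proof. by split=> [|u v]; [reflexivity|symmetry; exact: pmulE]. Qed.
HB.instance Definition _ := GRing.isMonoidMorphism.Build F presented_alg
  ppi ppi_monoid.

Lemma presented_scalerAl (a : K) (x y : presented_alg) :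
  a *: (x * y) = a *: x * y.
Proof.
have [[u <-] [v <-]] := conj (ppi_surj x) (ppi_surj y).
by rewrite -rmorphM -!linearZ -rmorphM /= scalerAl.
Qed.

Lemma presented_scalerAr (a : K) (x y : presented_alg) :
  a *: (x * y) = x * (a *: y).
Proof.
have [[u <-] [v <-]] := conj (ppi_surj x) (ppi_surj y).
by rewrite -rmorphM -!linearZ -rmorphM /= scalerAr.
Qed.

Lemma ppi_rel u v : Rel (u - v) -> ppi u = ppi v.
Proof.
move=> Ruv; apply/qpi_eq/in_span_gen; exists 1, (u - v), 1; split=> //.
by rewrite mul1r mulr1.
Qed.

Lemma presented_neq0 (e : {rmorphism F -> K}) :
  scalable_for *%R e -> (forall r, Rel r -> e r = 0) ->
  (1 : presented_alg) != 0.
Proof.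
move=> eZ aug; apply/eqP => h.
have {h} : in_span ideal_gens 1.
  by rewrite -[1]subr0; apply/qpi_eq; rewrite raddf0.
have e0 x : in_span ideal_gens x -> e x = 0.
  elim=> [|c y z [u [r [v [/aug Rr ->]]]] _ IH]; first exact: raddf0.
  by rewrite rmorphD eZ !rmorphM /= Rr IH mulr0 mul0r mulr0 addr0.
by move/e0 => /eqP; rewrite rmorph1 oner_eq0.
Qed.

End Presentation.

Section LinearExtension.
Variables (K : fieldType) (T : choiceType).

Definition mext (V : lmodType K) (phi : T -> V) (f : {malg K[T]}) : V :=
  \sum_(t <- msupp f) f@_t *: phi t.

Lemma mextEw (V : lmodType K) (phi : T -> V) (f : {malg K[T]}) (d : {fset T}) :
  (msupp f `<=` d)%fset -> mext phi f = \sum_(t <- d) f@_t *: phi t.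
Proof.
move=> fd; apply: big_fset_incl => // t _ /mcoeff_outdom ->.
by rewrite scale0r.
Qed.

Lemma mextP (V : lmodType K) (phi : T -> V) a f g :
  mext phi (a *: f + g) = a *: mext phi f + mext phi g.
Proof.
set d := (msupp f `|` msupp g)%fset.
have hf : (msupp f `<=` d)%fset by exact: fsubsetUl.
have hg : (msupp g `<=` d)%fset by exact: fsubsetUr.
have hfg : (msupp (a *: f + g) `<=` d)%fset.
  apply: fsubset_trans (msuppD_le _ _) _; apply: fsetSU; exact: msuppZ_le.
rewrite (mextEw _ hf) (mextEw _ hg) (mextEw _ hfg) scaler_sumr -big_split.
by apply: eq_bigr => t _ /=; rewrite mcoeffD mcoeffZ scalerDl scalerA.
Qed.

Lemma mextU (V : lmodType K) (phi : T -> V) t : mext phi << t >> = phi t.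
Proof.
by rewrite (mextEw _ (@msuppU_le _ _ t 1)) big_seq_fset1 mcoeffUU scale1r.
Qed.

Lemma mext0 (V : lmodType K) (phi : T -> V) : mext phi 0 = 0.
Proof. by rewrite /mext msupp0 big_seq_fset0. Qed.

Lemma mext_eq (V : lmodType K) (phi psi : T -> V) f :
  phi =1 psi -> mext phi f = mext psi f.
Proof. by move=> h; apply: eq_bigr => t _; rewrite h. Qed.

Lemma mextD (V : lmodType K) (phi : T -> V) f g :
  mext phi (f + g) = mext phi f + mext phi g.
Proof. by rewrite -[f]scale1r mextP !scale1r. Qed.

Lemma mextZ (V : lmodType K) (phi : T -> V) a f :
  mext phi (a *: f) = a *: mext phi f.
Proof. by rewrite -[_ *: f]addr0 mextP mext0 addr0. Qed.

Lemma mext_linr (V : lmodType K) (phi psi : T -> V) a f :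
  mext (fun t => a *: phi t + psi t) f = a *: mext phi f + mext psi f.
Proof.
rewrite /mext scaler_sumr -big_split; apply: eq_bigr => t _ /=.
by rewrite scalerDr !scalerA mulrC.
Qed.

Lemma malg_ind (P : {malg K[T]} -> Prop) :
  P 0 -> (forall a t f, P f -> P (a *: << t >> + f)) -> forall f, P f.
Proof.
move=> P0 PD f; rewrite (monalgE f).
elim/big_rec: _ => // t g _ Pg.
have -> : << f@_t *g t >> = f@_t *: << t >>; last exact: PD.
by apply/malgP => u; rewrite mcoeffZ !mcoeffU mulrnAr mulr1.
Qed.

End LinearExtension.

Section BilinearProduct.
Variables (K : fieldType) (T : Type) (V : lmodType K) (g : T -> V).
Variables (op : T -> T -> T) (e : T) (mu : V -> V -> V).
Hypothesis ind : forall P : V -> Prop,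
  P 0 -> (forall a t v, P v -> P (a *: g t + v)) -> forall v, P v.
Hypothesis muPl : forall a u u' v, mu (a *: u + u') v = a *: mu u v + mu u' v.
Hypothesis muPr : forall a u v v', mu u (a *: v + v') = a *: mu u v + mu u v'.
Hypothesis muU : forall p q, mu (g p) (g q) = g (op p q).

Lemma bil_mulDl : left_distributive mu +%R.
Proof. by move=> u u' v; rewrite -[u]scale1r muPl !scale1r. Qed.
Lemma bil_mulDr : right_distributive mu +%R.
Proof. by move=> u v v'; rewrite -[v]scale1r muPr !scale1r. Qed.
Lemma bil_mul0l v : mu 0 v = 0.
Proof. by apply: (addIr (mu 0 v)); rewrite -bil_mulDl !add0r. Qed.
Lemma bil_mul0r v : mu v 0 = 0.
Proof. by apply: (addIr (mu v 0)); rewrite -bil_mulDr !add0r. Qed.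
Lemma bil_mulZl a u v : a *: mu u v = mu (a *: u) v.
Proof. by rewrite -[_ *: u]addr0 muPl bil_mul0l addr0. Qed.
Lemma bil_mulZr a u v : a *: mu u v = mu u (a *: v).
Proof. by rewrite -[_ *: v]addr0 muPr bil_mul0r addr0. Qed.

Lemma bil_mulA : associative op -> associative mu.
Proof.
move=> opA u v w.
elim/ind: u => [|a p u IH]; first by rewrite !bil_mul0l.
rewrite !muPl IH; congr (_ *: _ + _) => {IH u}.
elim/ind: v => [|b q v IHv]; first by rewrite bil_mul0l !bil_mul0r bil_mul0l.
rewrite muPl !muPr muPl IHv; congr (_ *: _ + _) => {IHv v}.
elim/ind: w => [|c r w IHw]; first by rewrite !bil_mul0r.
by rewrite !muPr IHw !muU opA.
Qed.

Lemma bil_mul1l : left_id e op -> left_id (g e) mu.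
Proof.
move=> op1; elim/ind => [|c p f IH]; first by rewrite bil_mul0r.
by rewrite muPr IH muU op1.
Qed.

Lemma bil_mul1r : right_id e op -> right_id (g e) mu.
Proof.
move=> op1; elim/ind => [|c p f IH]; first by rewrite bil_mul0l.
by rewrite muPl IH muU op1.
Qed.

End BilinearProduct.

(* The tensor product A ⊗ B of algebras: linear combinations of pairs (a, b)
   modulo bilinearity, with (a ⊗ b) (a' ⊗ b') = a a' ⊗ b b'. The pairs span the
   algebra [pair_alg] of the monoid A × B, and the product of a bilinearity
   relator and a pair is again a bilinearity relator, so the ideal generated by
   these relators is their linear span. *)
Section Tensor.
Variables (K : fieldType) (A B : algType K).

Definition pair_alg : Type := {malg K[(A * B)%type]}.
HB.instance Definition _ := GRing.Lmodule.on pair_alg.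

Definition pgen (p : A * B) : pair_alg := << p >>.
Definition pair_op (p q : A * B) : A * B := (p.1 * q.1, p.2 * q.2).
Definition pair_mul (f g : pair_alg) : pair_alg :=
  mext (fun p => mext (fun q => pgen (pair_op p q)) g) f.

Lemma pair_ind (P : pair_alg -> Prop) :
  P 0 -> (forall a p f, P f -> P (a *: pgen p + f)) -> forall f, P f.
Proof. exact: malg_ind. Qed.

Lemma pair_mulPl a f f' g :
  pair_mul (a *: f + f') g = a *: pair_mul f g + pair_mul f' g.
Proof. exact: mextP. Qed.

Lemma pair_mulPr a f g g' :
  pair_mul f (a *: g + g') = a *: pair_mul f g + pair_mul f g'.
Proof.
rewrite /pair_mul -mext_linr; apply: mext_eq => p; exact: mextP.
Qed.

Lemma pair_mulU p q : pair_mul (pgen p) (pgen q) = pgen (pair_op p q).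
Proof. by rewrite /pair_mul !mextU. Qed.

Lemma pair_opA : associative pair_op.
Proof. by move=> p q r; rewrite /pair_op /= !mulrA. Qed.
Lemma pair_op1 : left_id (1, 1) pair_op.
Proof. by case=> a b; rewrite /pair_op /= !mul1r. Qed.
Lemma pair_op1r : right_id (1, 1) pair_op.
Proof. by case=> a b; rewrite /pair_op /= !mulr1. Qed.

Lemma pgen1_neq0 : pgen (1, 1) != 0.
Proof. by rewrite monalgU_eq0 oner_eq0. Qed.

HB.instance Definition _ := GRing.Zmodule_isNzRing.Build pair_alg
  (bil_mulA pair_ind pair_mulPl pair_mulPr pair_mulU pair_opA)
  (bil_mul1l pair_ind pair_mulPr pair_mulU pair_op1)
  (bil_mul1r pair_ind pair_mulPl pair_mulU pair_op1r)
  (bil_mulDl pair_mulPl) (bil_mulDr pair_mulPr) pgen1_neq0.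
HB.instance Definition _ := GRing.Lmodule_isLalgebra.Build K pair_alg
  (bil_mulZl pair_mulPl).
HB.instance Definition _ := GRing.Lalgebra_isAlgebra.Build K pair_alg
  (bil_mulZr pair_mulPr).

Inductive bilin_relator : set pair_alg :=
| bilinDl a a' b :
    bilin_relator (pgen (a + a', b) - (pgen (a, b) + pgen (a', b)))
| bilinDr a b b' :
    bilin_relator (pgen (a, b + b') - (pgen (a, b) + pgen (a, b')))
| bilinZl c a b : bilin_relator (pgen (c *: a, b) - c *: pgen (a, b))
| bilinZr c a b : bilin_relator (pgen (a, c *: b) - c *: pgen (a, b)).

Definition tensor : Type := presented_alg bilin_relator.
HB.instance Definition _ := GRing.PzRing.on tensor.
HB.instance Definition _ := GRing.Lmodule.on tensor.

Definition tens (a : A) (b : B) : tensor := ppi bilin_relator (pgen (a, b)).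

Lemma tens1 : tens 1 1 = 1. Proof. by []. Qed.

Lemma tensM a a' b b' : tens a b * tens a' b' = tens (a * a') (b * b').
Proof.
rewrite /tens -[RHS]/(ppi _ (pgen (pair_op (a, b) (a', b')))) -pair_mulU.
by rewrite rmorphM.
Qed.

Lemma tensDl a a' b : tens (a + a') b = tens a b + tens a' b.
Proof. by rewrite /tens -raddfD; apply/ppi_rel/bilinDl. Qed.
Lemma tensDr a b b' : tens a (b + b') = tens a b + tens a b'.
Proof. by rewrite /tens -raddfD; apply/ppi_rel/bilinDr. Qed.
Lemma tensZl c a b : tens (c *: a) b = c *: tens a b.
Proof. by rewrite /tens -linearZ; apply/ppi_rel/bilinZl. Qed.
Lemma tensZr c a b : tens a (c *: b) = c *: tens a b.
Proof. by rewrite /tens -linearZ; apply/ppi_rel/bilinZr. Qed.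

Definition tensl (a : A) : tensor := tens a 1.
Definition tensr (b : B) : tensor := tens 1 b.

Lemma tensl_zmod : zmod_morphism tensl.
Proof. by move=> a a'; rewrite /tensl -scaleN1r tensDl tensZl scaleN1r. Qed.
HB.instance Definition _ := GRing.isZmodMorphism.Build A tensor tensl tensl_zmod.
Lemma tensr_zmod : zmod_morphism tensr.
Proof. by move=> b b'; rewrite /tensr -scaleN1r tensDr tensZr scaleN1r. Qed.
HB.instance Definition _ := GRing.isZmodMorphism.Build B tensor tensr tensr_zmod.

Lemma tensl_monoid : monoid_morphism tensl.
Proof. by split=> // a a'; rewrite /tensl tensM mulr1. Qed.
HB.instance Definition _ := GRing.isMonoidMorphism.Build A tensor tensl tensl_monoid.
Lemma tensr_monoid : monoid_morphism tensr.
Proof. by split=> // b b'; rewrite /tensr tensM mulr1. Qed.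
HB.instance Definition _ := GRing.isMonoidMorphism.Build B tensor tensr tensr_monoid.

End Tensor.

(* [laurent A]: formal series \sum_i a_i z^i, i : int, with a_i = 0 for i large,
   i.e. Laurent series in z^-1 with coefficients in A. *)

Record laurent (A : zmodType) := Laurent {
  lcoef :> int -> A;
  lcoef_bound : exists N : int, forall i : int, N < i -> lcoef i = 0 }.
HB.instance Definition _ (A : zmodType) := gen_eqMixin (laurent A).
HB.instance Definition _ (A : zmodType) := gen_choiceMixin (laurent A).

Section LaurentZmod.
Variable A : zmodType.
Implicit Types f g : laurent A.

Lemma laurentP f g : (forall i, f i = g i) <-> f = g.
Proof.
split=> [|-> //]; case: f g => f hf [g hg] /= /funext fg; case: _ / fg hg => hg.
by congr Laurent; exact: Prop_irrelevance.
Qed.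

Lemma lcoef_boundW f (M : int) :
  exists2 N : int, M <= N & forall i : int, N < i -> f i = 0.
Proof.
have [N hN] := lcoef_bound f; exists (Num.max M N); first by rewrite le_max lexx.
by move=> i; rewrite gt_max => /andP[_ /hN].
Qed.

Fact lzero_bound : exists N : int, forall i : int, N < i -> (0 : A) = 0.
Proof. by exists 0. Qed.
Definition lzero := Laurent lzero_bound.

Fact lopp_bound f : exists N : int, forall i : int, N < i -> - f i = 0.
Proof. by have [N h] := lcoef_bound f; exists N => i /h ->; rewrite oppr0. Qed.
Definition lopp f := Laurent (lopp_bound f).

Fact ladd_bound f g : exists N : int, forall i : int, N < i -> f i + g i = 0.
Proof.
have [M hM] := lcoef_bound f; have [N MN hN] := lcoef_boundW g M.
by exists N => i Ni; rewrite hM ?hN ?add0r // (le_lt_trans MN).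
Qed.
Definition ladd f g := Laurent (ladd_bound f g).

Lemma laddA : associative ladd.
Proof. by move=> f g h; apply/laurentP => i /=; rewrite addrA. Qed.
Lemma laddC : commutative ladd.
Proof. by move=> f g; apply/laurentP => i /=; rewrite addrC. Qed.
Lemma ladd0 : left_id lzero ladd.
Proof. by move=> f; apply/laurentP => i /=; rewrite add0r. Qed.
Lemma laddN : left_inverse lzero lopp ladd.
Proof. by move=> f; apply/laurentP => i /=; rewrite addNr. Qed.
HB.instance Definition _ := GRing.isZmodule.Build (laurent A) laddA laddC ladd0 laddN.

Lemma lcoef0 i : (0 : laurent A) i = 0. Proof. by []. Qed.
Lemma lcoefD f g i : (f + g) i = f i + g i. Proof. by []. Qed.
Lemma lcoefN f i : (- f) i = - f i. Proof. by []. Qed.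
Lemma lcoefB f g i : (f - g) i = f i - g i. Proof. by []. Qed.

(* a z^n *)
Fact lmono_bound n (a : A) :
  exists N : int, forall i : int, N < i -> (if i == n then a else 0) = 0.
Proof. by exists n => i /gt_eqF ->. Qed.
Definition lmono n a := Laurent (lmono_bound n a).
Definition lconst a := lmono 0 a.

(* \sum_(m >= 0) a_m z^-m *)
Fact lser_bound (a : nat -> A) :
  exists N : int, forall i : int, N < i -> (if i <= 0 then a `|i|%N else 0) = 0.
Proof. by exists 0 => i i0; rewrite leNgt i0. Qed.
Definition lser a := Laurent (lser_bound a).

Lemma lserN a (m : nat) : lser a (- m%:Z) = a m.
Proof. by rewrite /= oppr_le0 lez_nat abszN absz_nat. Qed.
Lemma lser_gt0 a (i : int) : 0 < i -> lser a i = 0.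
Proof. by move=> i0; rewrite /= leNgt i0. Qed.

(* Coefficientwise convergence; for series without positive powers of z this is
   convergence in the z^-1-adic topology. *)
Definition is_lsum (f : nat -> laurent A) (S : laurent A) : Prop :=
  forall i, exists N, forall n, (N <= n)%N -> (\sum_(k < n) f k) i = S i.

Definition is_powser f : Prop := forall i, 0 < i -> f i = 0.

Definition residue f : A := f (-1).
Lemma residue_zmod : zmod_morphism residue. Proof. by []. Qed.
HB.instance Definition _ := GRing.isZmodMorphism.Build (laurent A) A residue
  residue_zmod.

End LaurentZmod.

Section LaurentLmod.
Variables (K : pzRingType) (A : lmodType K).
Implicit Types f g : laurent A.

Fact lscale_bound (c : K) f : exists N : int, forall i : int, N < i -> c *: f i = 0.
Proof. by have [N h] := lcoef_bound f; exists N => i /h ->; rewrite scaler0. Qed.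
Definition lscale c f := Laurent (lscale_bound c f).

Lemma lscaleA a b f : lscale a (lscale b f) = lscale (a * b) f.
Proof. by apply/laurentP => i /=; rewrite scalerA. Qed.
Lemma lscale1 : left_id 1 lscale.
Proof. by move=> f; apply/laurentP => i /=; rewrite scale1r. Qed.
Lemma lscaleDr : right_distributive lscale +%R.
Proof. by move=> a f g; apply/laurentP => i /=; rewrite scalerDr. Qed.
Lemma lscaleDl f : {morph lscale^~ f : a b / a + b}.
Proof. by move=> a b; apply/laurentP => i /=; rewrite scalerDl. Qed.
HB.instance Definition _ := GRing.Zmodule_isLmodule.Build K (laurent A)
  lscaleA lscale1 lscaleDr lscaleDl.

Lemma lcoefZ c f i : (c *: f) i = c *: f i. Proof. by []. Qed.

End LaurentLmod.

Section LaurentMap.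
Variables (A B : zmodType) (phi : {additive A -> B}).

Fact lmap_bound (f : laurent A) :
  exists N : int, forall i : int, N < i -> phi (f i) = 0.
Proof. by have [N h] := lcoef_bound f; exists N => i /h ->; rewrite raddf0. Qed.
Definition lmap f := Laurent (lmap_bound f).

Lemma lmap_zmod : zmod_morphism lmap.
Proof. by move=> f g; apply/laurentP => i /=; rewrite raddfB. Qed.
HB.instance Definition _ := GRing.isZmodMorphism.Build (laurent A) (laurent B)
  lmap lmap_zmod.

End LaurentMap.

Section LaurentRing.
Variable A : pzRingType.
Implicit Types f g h : laurent A.

(* All but finitely many terms of this sum vanish. *)
Definition lmul_coef f g (i : int) : A := \sum_(j \in [set: int]) f j * g (i - j).

Lemma lmul_coefE f g (M N : int) (m : nat) :
  (forall i : int, M < i -> f i = 0) -> (forall i : int, N < i -> g i = 0) ->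
  lmul_coef f g (M + N - m%:Z) = \sum_(k < m.+1) f (M - k%:Z) * g (N - (m - k)%N%:Z).
Proof.
move=> hf hg; rewrite /lmul_coef.
pose r : seq int := [seq M - k%:Z | k : nat <- iota 0 m.+1].
have ur : uniq r by rewrite map_inj_uniq ?iota_uniq // => x y /addrI /oppr_inj [].
have rT : [set` r] `<=` [set: int] by [].
rewrite (@fsbigE _ _ _ _ _ r _ ur rT) => [|j _ jn].
  rewrite big_map -[iota 0 m.+1]/(index_iota 0 m.+1) big_mkord.
  apply: eq_big => [k|k _]; first by rewrite in_setT.
  by congr (_ * g _); have := ltn_ord k; lia.
have [Mj|jM] := ltP M j; first by rewrite hf ?mul0r.
rewrite [g _]hg ?mulr0 //.
have [jm|mj] := ltnP `|M - j|%N m.+1; last by lia.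
case/negP: jn; apply/mapP; exists `|M - j|%N; first by rewrite mem_iota.
by lia.
Qed.

Lemma lmul_coef0 f g (M N : int) i :
  (forall i : int, M < i -> f i = 0) -> (forall i : int, N < i -> g i = 0) ->
  M + N < i -> lmul_coef f g i = 0.
Proof.
move=> hf hg Mi; apply: fsbig1 => j _.
have [Mj|jM] := ltP M j; first by rewrite hf ?mul0r.
by rewrite [g _]hg ?mulr0 //; lia.
Qed.

Fact lmul_bound f g : exists N : int, forall i : int, N < i -> lmul_coef f g i = 0.
Proof.
have [M hM] := lcoef_bound f; have [N hN] := lcoef_bound g.
by exists (M + N) => i; exact: lmul_coef0.
Qed.
Definition lmul f g := Laurent (lmul_bound f g).

Lemma triangle_sum (G : nat -> nat -> A) m :
  \sum_(k < m.+1) \sum_(l < (m - k).+1) G k l =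
  \sum_(k < m.+1) \sum_(j < k.+1) G j (k - j)%N.
Proof.
elim: m => [|m IH]; first by rewrite !big_ord1.
rewrite big_ord_recr /= [RHS]big_ord_recr /= -IH subnn big_ord1.
rewrite [X in _ = _ + X]big_ord_recr /= subnn addrA; congr (_ + _).
rewrite -big_split; apply: eq_bigr => k _ /=.
by rewrite subSn -1?ltnS // big_ord_recr.
Qed.

Lemma lmulA : associative lmul.
Proof.
move=> f g h; apply/laurentP => i.
have [P hP] := lcoef_bound h; have [N hN] := lcoef_bound g.
have [M Mi hM] := lcoef_boundW f (i - N - P).
have [m ->] : exists m : nat, i = M + N + P - m%:Z.
  by exists (absz (M + N + P - i)%R); lia.
have hfg (j : int) : M + N < j -> lmul f g j = 0 by exact: lmul_coef0.
have hgh (j : int) : N + P < j -> lmul g h j = 0 by exact: lmul_coef0.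
rewrite [RHS](lmul_coefE _ hfg hP) -[in LHS](addrA M).
rewrite [LHS](lmul_coefE _ hM hgh) /=.
under eq_bigr => k _ do rewrite (lmul_coefE _ hN hP) big_distrr /=.
under [RHS]eq_bigr => k _ do rewrite (lmul_coefE _ hM hN) big_distrl /=.
pose F (a b c : nat) := f (M - a%:Z) * g (N - b%:Z) * h (P - c%:Z).
pose G k l := F k l (m - k - l)%N.
transitivity (\sum_(k < m.+1) \sum_(l < (m - k).+1) G k l).
  by apply: eq_bigr => k _; apply: eq_bigr => l _; rewrite /G /F mulrA.
rewrite triangle_sum; apply: eq_bigr => k _; apply: eq_bigr => j _.
rewrite /G /F; congr (_ * h (P - (_ : nat)%:Z)).
by have := ltn_ord k; have := ltn_ord j; lia.
Qed.

Lemma lmul1 : left_id (lconst 1) lmul.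
Proof.
move=> f; apply/laurentP => i /=; rewrite /lmul_coef.
rewrite (@fsbigE _ _ _ _ _ [:: 0 : int]) // => [|j _].
  by rewrite big_mkcond big_seq1 in_setT /= mul1r subr0.
by rewrite inE /= => /negbTE ->; rewrite mul0r.
Qed.

Lemma lmul1r : right_id (lconst 1) lmul.
Proof.
move=> f; apply/laurentP => i /=; rewrite /lmul_coef.
rewrite (@fsbigE _ _ _ _ _ [:: i]) // => [|j _].
  by rewrite big_mkcond big_seq1 in_setT /= subrr mulr1.
by rewrite inE /= subr_eq0 eq_sym => /negbTE ->; rewrite mulr0.
Qed.

Lemma lmulDl : left_distributive lmul +%R.
Proof.
move=> f g h; apply/laurentP => i /=.
have [P hP] := lcoef_bound h; have [N hN] := lcoef_bound g.
have [M' NM hM'] := lcoef_boundW f N.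
have [M Mi hM] := lcoef_boundW f (Num.max M' (i - P)).
have := Mi; rewrite ge_max => /andP[M'M iM].
have hg (j : int) : M < j -> g j = 0 by move=> Mj; apply: hN; lia.
have [m ->] : exists m : nat, i = M + P - m%:Z by exists (absz (M + P - i)%R); lia.
have hfg (j : int) : M < j -> (f + g) j = 0 by move=> Mj; rewrite lcoefD hM ?hg ?addr0.
rewrite !(lmul_coefE _ _ hP) // -big_split.
by apply: eq_bigr => k _ /=; rewrite mulrDl.
Qed.

Lemma lmulDr : right_distributive lmul +%R.
Proof.
move=> h f g; apply/laurentP => i /=.
have [P hP] := lcoef_bound h; have [N hN] := lcoef_bound g.
have [M' NM hM'] := lcoef_boundW f N.
have [M Mi hM] := lcoef_boundW f (Num.max M' (i - P)).
have := Mi; rewrite ge_max => /andP[M'M iM].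
have hg (j : int) : M < j -> g j = 0 by move=> Mj; apply: hN; lia.
have [m ->] : exists m : nat, i = P + M - m%:Z by exists (absz (P + M - i)%R); lia.
have hfg (j : int) : M < j -> (f + g) j = 0 by move=> Mj; rewrite lcoefD hM ?hg ?addr0.
rewrite !(lmul_coefE _ hP) // -big_split.
by apply: eq_bigr => k _ /=; rewrite mulrDr.
Qed.

HB.instance Definition _ := GRing.Zmodule_isPzRing.Build (laurent A)
  lmulA lmul1 lmul1r lmulDl lmulDr.

Lemma lcoefM f g i : (f * g) i = \sum_(j \in [set: int]) f j * g (i - j).
Proof. by []. Qed.

End LaurentRing.

Section LaurentCoef.
Variable A : pzRingType.
Implicit Types f g : laurent A.

Lemma lmonoMl n a f i : (lmono n a * f) i = a * f (i - n).
Proof.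
rewrite lcoefM (@fsbigE _ _ _ _ _ [:: n]) // => [|j _].
  by rewrite big_mkcond big_seq1 in_setT /= eqxx.
by rewrite inE /= => /negbTE ->; rewrite mul0r.
Qed.

Lemma lexpr_lt0 f r (i : int) :
  (forall j : int, -1 < j -> f j = 0) -> - r%:Z < i -> (f ^+ r) i = 0.
Proof.
move=> hf; elim: r i => [|r IH] i ri.
  by rewrite expr0 /= ifF //; lia.
rewrite exprS lcoefM; apply: fsbig1 => j _.
have [j1|j1] := ltP (-1) j; first by rewrite hf ?mul0r.
by rewrite IH ?mulr0 //; lia.
Qed.

End LaurentCoef.

Section GeneratingSeries.
Variables (K : fieldType) (A : algType K) (hbar : K) (x : nat -> A).

(* x(u) = hbar \sum_(r >= 0) x_r u^(-r-1) *)
Definition xser : laurent A := lser (fun m => if m is r.+1 then hbar *: x r else 0).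

(* In [laurent (laurent A)] the inner variable is u and the outer one is s;
   (u - s)^-1 = - \sum_(j >= 0) u^j s^(-j-1). *)
Definition inv_u_sub_s : laurent (laurent A) :=
  lser (fun m => if m is j.+1 then - lmono j%:Z 1 else 0).

Lemma inv_u_sub_sP : (lconst (lmono 1 1) - lmono 1 1) * inv_u_sub_s = 1.
Proof.
rewrite mulrBl; apply/laurentP => i; rewrite lcoefB /lconst !lmonoMl mul1r subr0.
have uX j : lmono 1 1 * lmono j%:Z 1 = lmono j.+1%:Z 1 :> laurent A.
  apply/laurentP => k; rewrite lmonoMl mul1r /=.
  by rewrite subr_eq -[in j.+1]addn1 PoszD.
have [i0|[m ->]] : 0 < i \/ exists m : nat, i = - m%:Z.
  by have [i0|i0] := ltP 0 i; [left|right; exists (absz i); lia].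
  rewrite [inv_u_sub_s i]lser_gt0 // mulr0 sub0r.
  have [i1|->] : 1 < i \/ i = 1 by lia.
    by rewrite lser_gt0 ?oppr0 /= ?gt_eqF //; lia.
  by rewrite subrr -[0]oppr0 lserN oppr0.
have -> : - m%:Z - 1 = - m.+1%:Z by lia.
rewrite !lserN; case: m => [|j]; first by rewrite mulr0 sub0r opprK.
by rewrite mulrN uX opprK addNr.
Qed.

(* x(u - s) in A[u][[s^-1]]; the terms with r >= m do not contribute to the
   coefficient of s^-m, see [xshiftP]. *)
Definition xshift : laurent (laurent A) :=
  lser (fun m => \sum_(r < m)
    hbar *: (lconst (x r) * (inv_u_sub_s ^+ r.+1) (- m%:Z))).

Lemma xshiftP :
  is_lsum (fun r => hbar *: (lconst (lconst (x r)) * inv_u_sub_s ^+ r.+1)) xshift.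
Proof.
have hinv (j : int) : -1 < j -> inv_u_sub_s j = 0.
  move=> j1; have [j0|->] : 0 < j \/ j = - 0%:Z by lia.
    exact: lser_gt0.
  exact: lserN.
have coefE n i : (\sum_(r < n) hbar *: (lconst (lconst (x r)) * inv_u_sub_s ^+ r.+1)) i
    = \sum_(r < n) hbar *: (lconst (x r) * (inv_u_sub_s ^+ r.+1) i).
  elim: n => [|n IH]; first by rewrite !big_ord0.
  rewrite 2!big_ord_recr lcoefD IH; congr (_ + _).
  by rewrite lcoefZ [X in _ *: X]lmonoMl subr0.
move=> i; exists (absz i) => n ni; rewrite coefE.
have [i0|i0] := ltP 0 i.
  rewrite lser_gt0 // big1 // => r _.
  by rewrite lexpr_lt0 ?mulr0 ?scaler0 //; lia.
have [m im] : exists m : nat, i = - m%:Z by exists (absz i); lia.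
have {}ni : (m <= n)%N by lia.
rewrite im lserN -(subnK ni) addnC big_split_ord /= [X in _ + X]big1 ?addr0 //.
by move=> r _; rewrite lexpr_lt0 ?mulr0 ?scaler0 //; lia.
Qed.

End GeneratingSeries.

Definition bracket (A : pzRingType) (a b : A) : A := a * b - b * a.

(* Generators of the Yangian: [inl r] is xi_r; [inr (b, r)] is x^+_r if b is
   false and x^-_r if b is true, so that ± is (-1) ^+ b. *)
Definition ygen : choiceType := (nat + bool * nat)%type.

Section YangianRelators.
Variables (K : fieldType) (hbar : K) (A : algType K).
Variables (xi : nat -> A) (x : bool -> nat -> A).

Inductive yangian_relator : set A :=
| rel_xi_xi r s : yangian_relator (bracket (xi r) (xi s))
| rel_xi0_x b s :
    yangian_relator (bracket (xi 0%N) (x b s) - ((-1) ^+ b * 2) *: x b s)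
| rel_xi_x b r s :
    yangian_relator (bracket (xi r.+1) (x b s) - bracket (xi r) (x b s.+1)
      - ((-1) ^+ b * hbar) *: (xi r * x b s + x b s * xi r))
| rel_x_x b r s :
    yangian_relator (bracket (x b r.+1) (x b s) - bracket (x b r) (x b s.+1)
      - ((-1) ^+ b * hbar) *: (x b r * x b s + x b s * x b r))
| rel_xp_xm r s :
    yangian_relator (bracket (x false r) (x true s) - xi (r + s)%N).

Lemma yangian_relator_aug (e : {rmorphism A -> K}) : scalable_for *%R e ->
  (forall r, e (xi r) = 0) -> (forall b r, e (x b r) = 0) ->
  forall w, yangian_relator w -> e w = 0.
Proof.
move=> eZ exi ex w.
by case=> *; rewrite !(rmorphB, rmorphD, rmorphM, eZ) /= ?exi ?ex
  ?(mul0r, mulr0, addr0, subr0).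
Qed.

End YangianRelators.

Definition free_xi (K : fieldType) (r : nat) : free_alg K ygen :=
  fgen K (inl r : ygen).
Definition free_x (K : fieldType) (b : bool) (r : nat) : free_alg K ygen :=
  fgen K (inr (b, r) : ygen).

Section Yangian.
Variables (K : fieldType) (hbar : K).

Local Notation F := (free_alg K ygen).

Definition free_relator : set F :=
  yangian_relator hbar (@free_xi K) (@free_x K).

Definition yangian : Type := presented_alg free_relator.
HB.instance Definition _ := GRing.PzRing.on yangian.
HB.instance Definition _ := GRing.Lmodule.on yangian.

Lemma yangian_oner_neq0 : (1 : yangian) != 0.
Proof.
pose e : {rmorphism F -> K} := @mcoeff {fmonom ygen} K mone.
have e0 g : e (fgen K g) = 0.
  rewrite /e /= mcoeffU; case: (fmu g =P mone) => [h|//].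
  by have := fdegU g; rewrite h fdeg1.
have eZ : scalable_for *%R e by move=> a f; exact: mcoeffZ.
apply: (@presented_neq0 _ _ _ e eZ) => r.
by apply: yangian_relator_aug => // *; exact: e0.
Qed.
HB.instance Definition _ :=
  GRing.PzSemiRing_isNonZero.Build yangian yangian_oner_neq0.
HB.instance Definition _ := GRing.Lmodule_isLalgebra.Build K yangian
  (@presented_scalerAl K F free_relator).
HB.instance Definition _ := GRing.Lalgebra_isAlgebra.Build K yangian
  (@presented_scalerAr K F free_relator).

Local Notation Y := yangian.
Local Notation YY := (tensor Y Y).

Definition yxi (r : nat) : Y := ppi free_relator (free_xi K r).
Definition yx (b : bool) (r : nat) : Y := ppi free_relator (free_x K b r).
Definition yxp : nat -> Y := yx false.
Definition yxm : nat -> Y := yx true.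

Definition t1 : Y := yxi 1%N - (hbar / 2) *: yxi 0%N ^+ 2.

Definition ywt (n : int) : set Y :=
  [set y | bracket (yxi 0%N) y = (2 * n)%:~R *: y].

(* P ⊗ Q, as a series in s, for P in Y[u][[s^-1]] and Q in Y[[u^-1]]. *)
Definition ltens (P : laurent (laurent Y)) (Q : laurent Y) : laurent (laurent YY) :=
  lmap (lmap (@tensl K Y Y)) P * lconst (lmap (@tensr K Y Y) Q).

Definition omega (k : nat) : laurent YY :=
  ((-1) ^+ k / (k%:R * hbar)) *:
    lmap (@residue YY) (ltens (xshift hbar yxm ^+ k) (xser hbar yxp ^+ k)).

(* The subspace Y_(-n alpha) ⊗ Y_(n alpha) of Y ⊗ Y. *)
Definition wt_tensor (n : int) : set YY :=
  [set t | exists s : seq (Y * Y),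
     (forall p, p \in s -> ywt (- n) p.1 /\ ywt n p.2) /\
     t = \sum_(p <- s) tens p.1 p.2].

Definition standard_coprod_t1 : laurent YY :=
  lconst (tens t1 1 + tens 1 t1) + lmono 1 (tens (yxi 0%N) 1).

Definition drinfeld_coprod_t1 : laurent YY :=
  standard_coprod_t1 - lconst ((2 * hbar) *: tens (yxm 0%N) (yxp 0%N)).

Definition is_Rminus (R : laurent YY) : Prop :=
  exists Rn : nat -> laurent YY,
    [/\ forall n, is_powser (Rn n) /\ forall i, wt_tensor n%:Z (Rn n i),
        Rn 0%N = lconst (tens 1 1),
        is_lsum Rn R &
        R * drinfeld_coprod_t1 = standard_coprod_t1 * R].

End Yangian.

Definition compositions (n : nat) : set (seq nat) :=
  [set k | all (leq 1) k /\ sumn k = n].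

Lemma finite_compositions n : finite_set (compositions n).
Proof.
apply: (@sub_finite_set _ _
  [set [seq val i | i <- bseqval t] | t in [set: n.-bseq 'I_n.+1]]); last first.
  exact/finite_image/finite_finset.
move=> k [k1 kn].
have kle i : i \in k -> (i < n.+1)%N.
  rewrite ltnS -kn sumnE => ik; rewrite (big_rem i) //=; exact: leq_addr.
have ks : (size k <= n)%N.
  rewrite -kn; elim: k k1 {kn kle} => //= i k IH /andP[i1 /IH]; lia.
have ks' : (size [seq (inord i : 'I_n.+1) | i <- k] <= n)%N by rewrite size_map.
exists (Bseq ks') => //=; rewrite -map_comp -[RHS]map_id.
by apply/eq_in_map => i /kle ik /=; rewrite inordK.
Qed.

(* Main.v *)
From HB Require Import structures.
Require Import Defs.
From mathcomp Require Import all_boot all_order all_algebra.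
From mathcomp Require Import boolp classical_sets fsbigop reals complex.
From mathcomp Require Import finmap cardinality zify.
Import Order.TTheory GRing.Theory Num.Theory.
Local Open Scope classical_set_scope.
Local Open Scope ring_scope.
Set Implicit Arguments.
Unset Strict Implicit.
Unset Printing Implicit Defensive.

(** Write S for the standard coproduct of t_1 (the term s xi_0 ⊗ 1 included) and
    a = x_0^- ⊗ x_0^+. The defining equation is [S, R] = -2 hbar R a, that is,
    [S, R_n] = -2 hbar R_(n-1) a in every weight n.

    Uniqueness. Let d be the difference of two solutions, so that
    [S, d] = -2 hbar d a, and let c s^i be its leading term. The coefficient of
    s^(i+1) in this equation is [xi_0 ⊗ 1, c] = 0. But c is a finite sum of
    vectors of weights n >= 1, on which ad (xi_0 ⊗ 1) acts by the distinct
    nonzero scalars -2n, hence c = 0 ([graded_solution_unique]).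

    The formula. Every composition of n is a composition of some j < n followed
    by the last part n - j, and its coefficient is 1/n times that of the shorter
    composition. So the sums R_n over compositions are characterised by
    n R_n = sum_(j < n) R_j w_(n-j): they are the coefficients of the ordered
    exponential z R'(z) = R(z) w(z). As ad S is a derivation, induction on n
    reduces [S, R_n] = -2 hbar R_(n-1) a to the relations
        [S, w_1] = -2 hbar a    and    [S, w_(k+1)] = -2 hbar [w_k, a]
    ([bracket_Rterm]).

    The relations for w_k hold before the residue is taken. The defining
    relations of the Yangian say that the currents satisfy
        [x_0^±, x^±(u)] = ∓ x^±(u)^2,
        [t_1, x^±(u)] = ± 2 (u x^±(u) - hbar x_0^±).
    For Z = x^-(u-s) ⊗ 1 and X = -1 ⊗ x^+(u), whose sign absorbs the (-1)^k of
    w_k, both pairs take the same shape: with y = x_0^- ⊗ 1 and x = 1 ⊗ x_0^+,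
        [y, Z] = Z^2,   [S, Z] = -2 u Z + 2 hbar y,
        [x, X] = X^2,   [S, X] =  2 u X + 2 hbar x,
    the s in u - s being cancelled by the term s xi_0 ⊗ 1 of S. From this,
        [S, Z^(k+1) X^(k+1)] = 2 hbar (k+1) E_k   and   [Z^k X^k, y x] = - k E_k
    with one and the same E_k ([bracket_pair_pow], [bracket_pair_corner]), which
    gives the relations for k >= 1. For k = 0 the residue of
    E_0 = y X + Z x is - hbar a, because x^-(u-s) is polynomial in u. *)

(** * Commutators and powers *)

Section Bracket.
Variable L : pzRingType.
Implicit Types a b c h p q t x y X Z : L.

Lemma bracketDl a b c : bracket (a + b) c = bracket a c + bracket b c.
Proof. by rewrite /bracket mulrDl mulrDr opprD addrACA. Qed.
Lemma bracketDr a b c : bracket a (b + c) = bracket a b + bracket a c.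
Proof. by rewrite /bracket mulrDl mulrDr opprD addrACA. Qed.
Lemma bracketN a b : bracket a (- b) = - bracket a b.
Proof. by rewrite /bracket mulrN mulNr opprD. Qed.
Lemma bracket0 a : bracket a 0 = 0.
Proof. by rewrite /bracket mulr0 mul0r subrr. Qed.
Lemma bracket1 a : bracket a 1 = 0.
Proof. by rewrite /bracket mulr1 mul1r subrr. Qed.
Lemma bracketC a b : bracket a b = - bracket b a.
Proof. by rewrite /bracket opprB. Qed.
Lemma bracketMr a b c : bracket a (b * c) = bracket a b * c + b * bracket a c.
Proof. by rewrite /bracket mulrBl mulrBr !mulrA addrA subrK. Qed.
Lemma bracketMl a b c : bracket (a * b) c = a * bracket b c + bracket a c * b.
Proof. by rewrite /bracket mulrBl mulrBr !mulrA addrA subrK. Qed.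
Lemma bracket_sum a (I : Type) (r : seq I) (F : I -> L) :
  bracket a (\sum_(i <- r) F i) = \sum_(i <- r) bracket a (F i).
Proof.
by elim/big_rec2: _ => [|i x y _ <-]; rewrite ?bracket0 // bracketDr.
Qed.
Lemma bracketMn a b n : bracket a (b *+ n) = bracket a b *+ n.
Proof. by rewrite /bracket mulrnAr mulrnAl mulrnBl. Qed.
Lemma bracket_comm a b : GRing.comm a b -> bracket a b = 0.
Proof. by move=> h; rewrite /bracket h subrr. Qed.

Definition central a := forall b, a * b = b * a.

Lemma bracket_exp y Z k : bracket y Z = Z ^+ 2 ->
  bracket y (Z ^+ k) = Z ^+ k.+1 *+ k.
Proof.
move=> yZ; elim: k => [|k IH]; first by rewrite expr0 bracket1 mulr0n.
by rewrite exprS bracketMr yZ IH mulrnAr -exprD -exprS -mulrS.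
Qed.

Lemma bracket_exp_scalar h Z (c : int) k : bracket h Z = Z *~ c ->
  bracket h (Z ^+ k) = Z ^+ k *~ (c * k%:Z :> int).
Proof.
move=> hZ; elim: k => [|k IH]; first by rewrite expr0 bracket1 mulr0.
rewrite exprS bracketMr hZ IH mulrzAr mulrzAl -mulrzDr.
by rewrite -[k.+1]add1n PoszD mulrDr mulr1.
Qed.

(** The correction 'C(k+1, 2) counts the commutations [y, Z] = Z^2 needed to
    move each y to the left of all factors Z. *)
Lemma bracket_exp_quad y Z t p q k : central p -> central q ->
  bracket y Z = Z ^+ 2 -> bracket t Z = p * Z + q * y ->
  bracket t (Z ^+ k.+1) = (p * Z ^+ k.+1) *+ k.+1
    + q * (y * Z ^+ k *+ k.+1 - Z ^+ k.+1 *+ 'C(k.+1, 2)).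
Proof.
move=> cp cq yZ tZ; elim: k => [|k IH].
  by rewrite expr1 expr0 tZ mulr1 /= mulr0n subr0.
have Zy : Z ^+ k.+1 * y = y * Z ^+ k.+1 - Z ^+ k.+2 *+ k.+1.
  by rewrite -(bracket_exp _ yZ) /bracket opprB addrC subrK.
rewrite exprSr bracketMr IH tZ [X in _ + X]mulrDr (mulrA _ p) -cp (mulrA _ q) -cq.
rewrite -!mulrA Zy mulrDl mulrnAl -!mulrA -!exprSr mulrBl !mulrnAl.
rewrite -!mulrA -!exprSr addrACA -mulrDr -mulrSr; congr (_ + q * _).
by rewrite addrACA -mulrSr -opprD -mulrnDr [in RHS]binS bin1.
Qed.

(** Two commuting copies of one situation: (y, Z) stands for the current in the
    first tensor factor and (x, X) for the one in the second. *)
Section Pair.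
Variables y Z x X : L.
Hypotheses (yX : GRing.comm y X) (Zx : GRing.comm Z x).
Hypotheses (yZ : bracket y Z = Z ^+ 2) (xX : bracket x X = X ^+ 2).

Definition pair_pow k := Z ^+ k * X ^+ k.

(** The common right-hand side of [bracket_pair_pow] and [bracket_pair_corner]. *)
Definition pair_cross k :=
  y * Z ^+ k * X ^+ k.+1 + Z ^+ k.+1 * (x * X ^+ k) - pair_pow k.+1 *+ k.

(** The terms in p cancel because p enters with opposite signs; the two binomial
    corrections of [bracket_exp_quad] add up to k (k+1) Z^(k+1) X^(k+1). *)
Lemma bracket_pair_pow t s p q k :
  central p -> central q -> GRing.comm t X -> GRing.comm s Z ->
  bracket t Z = - p * Z + q * y -> bracket s X = p * X + q * x ->
  bracket (t + s) (pair_pow k.+1) = (q * pair_cross k) *+ k.+1.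
Proof.
move=> cp cq tX sZ tZ sX.
have cNp : central (- p) by move=> a; rewrite mulNr cp mulrN.
have tXk : bracket t (X ^+ k.+1) = 0 by apply/bracket_comm/commrX.
have sZk : bracket s (Z ^+ k.+1) = 0 by apply/bracket_comm/commrX.
rewrite bracketDl 2!bracketMr tXk sZk mulr0 addr0 mul0r add0r.
rewrite (bracket_exp_quad k cNp cq yZ tZ) (bracket_exp_quad k cp cq xX sX).
set c := 'C(k.+1, 2).
rewrite [X in X + _ = _](_ : _ = - (p * pair_pow k.+1 *+ k.+1)
    + q * ((y * Z ^+ k * X ^+ k.+1) *+ k.+1 - pair_pow k.+1 *+ c)); last first.
  by rewrite mulrDl mulrnAl !mulNr mulNrn -!mulrA mulrBl !mulrnAl /pair_pow !mulrA.
rewrite [X in _ + X = _](_ : _ = p * pair_pow k.+1 *+ k.+1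
    + q * ((Z ^+ k.+1 * (x * X ^+ k)) *+ k.+1 - pair_pow k.+1 *+ c)); last first.
  rewrite (mulrDr (Z ^+ _)) mulrnAr (mulrA _ p) -cp (mulrA _ q) -cq -!mulrA.
  by rewrite (mulrBr (Z ^+ _)) !mulrnAr.
rewrite addrACA addNr add0r -mulrDr -[RHS]mulrnAr; congr (q * _).
rewrite addrACA -opprD -mulrnDl -mulrnDr mulrnBl -mulrnA; congr (_ - _ *+ _).
by have := mul_bin_diag k.+1 1; rewrite bin1 /= -/c; lia.
Qed.

(** Moving y and x to the left of Z^k and X^k costs k Z^(k+1) and k X^(k+1); the
    product of the two uncorrected terms is y x Z^k X^k and drops out. *)
Lemma bracket_pair_corner k : bracket (pair_pow k) (y * x) = - (pair_cross k *+ k).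
Proof.
have Zy : Z ^+ k * y = y * Z ^+ k - Z ^+ k.+1 *+ k.
  by rewrite -(bracket_exp _ yZ) /bracket opprB addrC subrK.
have Xx : X ^+ k * x = x * X ^+ k - X ^+ k.+1 *+ k.
  by rewrite -(bracket_exp _ xX) /bracket opprB addrC subrK.
have yXk : X ^+ k * y = y * X ^+ k by apply/commr_sym/commrX.
have xZk : x * Z ^+ k = Z ^+ k * x by apply/commrX/commr_sym.
have xZk1 : x * Z ^+ k.+1 = Z ^+ k.+1 * x by apply/commrX/commr_sym.
rewrite /bracket /pair_pow mulrA -(mulrA _ _ y) yXk mulrA -mulrA Zy Xx.
rewrite mulrBl !mulrBr -(mulrA y x) (mulrA x) xZk.
rewrite /pair_cross /pair_pow -!(mulrA y) (mulrA _ x) !mulrnAr !mulrnAl !mulrA.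
by rewrite [LHS]addrC !addrA addNr add0r -opprD addrA mulrnBl mulrnDl.
Qed.
End Pair.
End Bracket.

(** * Laurent series: degrees, coefficients, residues *)

Section Degree.
Variable A : pzRingType.
Implicit Types f g : laurent A.

Definition deg_le (N : int) f := forall i : int, N < i -> f i = 0.

Lemma deg_leW M N f : M <= N -> deg_le M f -> deg_le N f.
Proof. by move=> MN hf i Ni; apply: hf; apply: le_lt_trans Ni. Qed.
Lemma deg_leD N f g : deg_le N f -> deg_le N g -> deg_le N (f + g).
Proof. by move=> hf hg i Ni; rewrite lcoefD hf ?hg ?addr0. Qed.
Lemma deg_leN N f : deg_le N f -> deg_le N (- f).
Proof. by move=> hf i Ni; rewrite lcoefN hf ?oppr0. Qed.
Lemma deg_leB N f g : deg_le N f -> deg_le N g -> deg_le N (f - g).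
Proof. by move=> hf hg; apply: deg_leD => //; apply: deg_leN. Qed.
Lemma deg_le_sum N (I : Type) (r : seq I) (P : pred I) (F : I -> laurent A) :
  (forall i, P i -> deg_le N (F i)) -> deg_le N (\sum_(i <- r | P i) F i).
Proof. by move=> hF; elim/big_ind: _ => // *; apply: deg_leD. Qed.
Lemma deg_leM M N f g : deg_le M f -> deg_le N g -> deg_le (M + N) (f * g).
Proof. by move=> hf hg i; apply: lmul_coef0. Qed.
Lemma deg_le_mono n (a : A) : deg_le n (lmono n a).
Proof. by move=> i ni /=; rewrite gt_eqF. Qed.
Lemma deg_le_const (a : A) : deg_le 0 (lconst a).
Proof. exact: deg_le_mono. Qed.
Lemma deg_leX f (k : nat) : deg_le (-1) f -> deg_le (- k%:Z) (f ^+ k).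
Proof. by move=> hf i; apply: lexpr_lt0. Qed.

(** Identities between series are proved modulo arbitrarily negative powers. *)
Lemma deg_le_eq f g (M : int) :
  (forall n : nat, deg_le (M - n%:Z) (f - g)) -> f = g.
Proof.
move=> h; apply/laurentP => i; apply/eqP; rewrite -subr_eq0 -lcoefB; apply/eqP.
by apply: (h (absz (M - i)).+1); lia.
Qed.

Lemma lmonoMr n (a : A) f i : (f * lmono n a) i = f (i - n) * a.
Proof.
rewrite lcoefM (@fsbigE _ _ _ _ _ [:: i - n]) // => [|j _].
  by rewrite big_mkcond big_seq1 in_setT /= subKr eqxx.
rewrite inE /= => h; rewrite ifF ?mulr0 //; apply/eqP => ij.
by move/eqP: h; apply; rewrite -ij; lia.
Qed.

Lemma lmonoM m n (a b : A) : lmono m a * lmono n b = lmono (m + n) (a * b).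
Proof.
apply/laurentP => i; rewrite lmonoMl /= subr_eq [n + m]addrC.
by case: ifP => _; rewrite ?mulr0.
Qed.

Lemma lconst_zmod : zmod_morphism (@lconst A).
Proof.
move=> a b; apply/laurentP => i; rewrite lcoefB /=.
by case: ifP => _; rewrite ?subr0.
Qed.
HB.instance Definition _ :=
  GRing.isZmodMorphism.Build A (laurent A) (@lconst A) lconst_zmod.
Lemma lconst_monoid : monoid_morphism (@lconst A).
Proof. by split=> // a b; rewrite /lconst lmonoM. Qed.
HB.instance Definition _ :=
  GRing.isMonoidMorphism.Build A (laurent A) (@lconst A) lconst_monoid.

Lemma central_lmono n (a : A) : central a -> central (lmono n a).
Proof. by move=> ca f; apply/laurentP => i; rewrite lmonoMl lmonoMr ca. Qed.

Lemma bracket_lconst a f i : bracket (lconst a) f i = bracket a (f i).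
Proof. by rewrite /bracket lcoefB lmonoMl lmonoMr subr0. Qed.

Lemma lcoef_mul_ind (P : A -> Prop) f g :
  P 0 -> (forall a b, P a -> P b -> P (a + b)) ->
  (forall i j, P (f i * g j)) -> forall i, P ((f * g) i).
Proof.
by move=> P0 PD PM i; rewrite lcoefM; elim/big_ind: _.
Qed.

End Degree.

Lemma bracket_morph (A B : pzRingType) (phi : {rmorphism A -> B}) a b :
  phi (bracket a b) = bracket (phi a) (phi b).
Proof. by rewrite /bracket rmorphB !rmorphM. Qed.

(** Stated with unrelated f' and g' so that it covers both ring morphisms and the
    residue, which is only linear over constants. *)
Lemma lmap_mul (A B : pzRingType) (phi : {additive A -> B})
    (f g : laurent A) (f' g' : laurent B) :
  (forall i j, phi (f i * g j) = f' i * g' j) -> lmap phi (f * g) = f' * g'.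
Proof.
move=> h; apply/laurentP => i /=.
have [M0 hM0] := lcoef_bound f; have [M MM hM'] := lcoef_boundW f' M0.
have [N0 hN0] := lcoef_bound g; have [N' NN hN'] := lcoef_boundW g' N0.
have [N Ni hN] := lcoef_boundW g' (Num.max N' (i - M)).
have hf j : M < j -> f j = 0 by move=> ?; apply: hM0; lia.
have hg j : N < j -> g j = 0.
  by move=> ?; apply: hN0; move: Ni; rewrite ge_max; lia.
have [m ->] : exists m : nat, i = M + N - m%:Z.
  by exists (absz (M + N - i)%R); move: Ni; rewrite ge_max; lia.
rewrite (lmul_coefE _ hf hg) [RHS](lmul_coefE _ hM' hN) raddf_sum.
by apply: eq_bigr => k _; rewrite h.
Qed.

Section MapRing.
Variables (A B : pzRingType) (phi : {rmorphism A -> B}).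
Lemma lmap_monoid : monoid_morphism (lmap phi).
Proof.
split=> [|f g]; last by apply: lmap_mul => i j; exact: (rmorphM phi).
apply/laurentP => i /=; case: ifP => _; [exact: rmorph1|exact: raddf0].
Qed.
HB.instance Definition _ :=
  GRing.isMonoidMorphism.Build (laurent A) (laurent B) (lmap phi) lmap_monoid.
End MapRing.

(** In a series over [laurent A], the elements [lmap (@lconst A) f] are those
    free of the inner variable. *)
Section ResidueLinear.
Variable A : pzRingType.
Lemma residueMl (f : laurent A) (g : laurent (laurent A)) :
  lmap (@residue A) (lmap (@lconst A) f * g) = f * lmap (@residue A) g.
Proof.
by apply: lmap_mul => i j; apply: etrans (lmonoMl _ _ _ _) _; rewrite subr0.
Qed.
Lemma residueMr (f : laurent A) (g : laurent (laurent A)) :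
  lmap (@residue A) (g * lmap (@lconst A) f) = lmap (@residue A) g * f.
Proof.
by apply: lmap_mul => i j; apply: etrans (lmonoMr _ _ _ _) _; rewrite subr0.
Qed.
Lemma bracket_residue (f : laurent A) (g : laurent (laurent A)) :
  lmap (@residue A) (bracket (lmap (@lconst A) f) g)
    = bracket f (lmap (@residue A) g).
Proof. by rewrite /bracket raddfB /= residueMl residueMr. Qed.
End ResidueLinear.

(** * Substituting an inverse into a generating series *)

(** S is the series sum_r c_r w^(-r-1), where w has degree 1 and inverse v. Both
    currents have this form: w = u gives x^+(u), w = u - s gives x^-(u-s). *)
Section SubstSeries.
Variables (A : pzRingType) (w v : laurent A).
Hypotheses (wC : central w) (w_deg : deg_le 1 w) (v_deg : deg_le (-1) v).
Hypothesis wv : w * v = 1.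
Variables (c : nat -> A) (S : laurent A).

Lemma inv_central : central v.
Proof.
move=> f; have vw : v * w = 1 by rewrite -wC wv.
by rewrite -[v * f]mulr1 -wv mulrA -(mulrA v) -(wC f) mulrA vw mul1r.
Qed.

Definition subst_psum (N : nat) := \sum_(r < N) lconst (c r) * v ^+ r.+1.
(** The rate of convergence is part of the definition: truncation at N is exact
    up to degree - N - 1, which controls products with positive powers of w. *)
Definition is_subst :=
  forall N : nat, deg_le (- N.+1%:Z) (S - subst_psum N).

Hypothesis hS : is_subst.

Lemma subst_deg : deg_le (-1) S.
Proof. by have := @hS 0; rewrite /subst_psum big_ord0 subr0. Qed.

Lemma deg_le_bracket (a : A) (f : laurent A) N :
  deg_le N f -> deg_le N (bracket (lconst a) f).
Proof.
move=> hf i Ni; rewrite bracket_lconst hf //; exact: bracket0.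
Qed.

Lemma bracket_psum t N :
  bracket (lconst t) (subst_psum N) = \sum_(r < N) lconst (bracket t (c r)) * v ^+ r.+1.
Proof.
rewrite bracket_sum; apply: eq_bigr => r _; rewrite bracketMr -bracket_morph.
rewrite (@bracket_comm _ _ (v ^+ _)) ?mulr0 ?addr0 //.
by apply/commrX/commr_sym/inv_central.
Qed.

Lemma deg_le_mulrz N (f : laurent A) (k : int) : deg_le N f -> deg_le N (f *~ k).
Proof.
move=> hf; have hn n : deg_le N (f *+ n).
  by elim: n => [|n IH]; rewrite ?mulr0n // mulrS; apply: deg_leD.
by case: k => n; rewrite ?NegzE ?mulrNz -?pmulrn //; apply: deg_leN.
Qed.

Lemma bracket_subst_scale t (k : int) :
  (forall r, bracket t (c r) = c r *~ k) -> bracket (lconst t) S = S *~ k.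
Proof.
move=> tc; apply: (@deg_le_eq _ _ _ (-1)) => N.
have eP : bracket (lconst t) (subst_psum N) = subst_psum N *~ k.
  rewrite bracket_psum mulrz_suml; apply: eq_bigr => r _.
  by rewrite tc raddfMz mulrzAl.
rewrite -[X in bracket _ X](subrK (subst_psum N)) bracketDr eP.
rewrite -[X in _ - X *~ _](subrK (subst_psum N)) mulrzDl opprD addrA addrAC.
rewrite addrK; apply: deg_leB.
  by apply: deg_le_bracket; apply: deg_leW (@hS N); lia.
by apply: deg_le_mulrz; apply: deg_leW (@hS N); lia.
Qed.

(** Multiplication by w shifts the coefficients and drops c_0 out. *)
Lemma bracket_subst_shift t (k : int) :
  (forall r, bracket t (c r) = c r.+1 *~ k) ->
  bracket (lconst t) S = (w * S - lconst (c 0)) *~ k.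
Proof.
move=> tc; apply: (@deg_le_eq _ _ _ (-1)) => N.
have eP : bracket (lconst t) (subst_psum N)
    = (w * subst_psum N.+1 - lconst (c 0)) *~ k.
  rewrite bracket_psum /subst_psum mulr_sumr big_ord_recl /=.
  have wP r : w * (lconst (c r) * v ^+ r.+1) = lconst (c r) * v ^+ r.
    by rewrite mulrA wC -mulrA exprS (mulrA w) wv mul1r.
  rewrite wP expr0 mulr1 addrAC subrr add0r mulrz_suml; apply: eq_bigr => r _.
  by rewrite wP tc raddfMz mulrzAl.
rewrite -[X in bracket _ X](subrK (subst_psum N)) bracketDr eP.
have -> : w * S = w * (S - subst_psum N.+1) + w * subst_psum N.+1.
  by rewrite -mulrDr subrK.
rewrite -[_ + _ - lconst _]addrA [X in deg_le _ (_ - X)]mulrzDl opprD addrA addrAC addrK.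
apply: deg_leB.
  by apply: deg_le_bracket; apply: deg_leW (@hS N); lia.
apply: deg_le_mulrz; apply: deg_leW (deg_leM w_deg (@hS N.+1)); lia.
Qed.

(** The coefficient of v^(n+2) in S^2 is the convolution of the c_a. *)
Lemma bracket_subst_square y :
  bracket y (c 0) = 0 ->
  (forall n, bracket y (c n.+1) = \sum_(a < n.+1) c a * c (n - a)%N) ->
  bracket (lconst y) S = S ^+ 2.
Proof.
move=> y0 yc; apply: (@deg_le_eq _ _ _ (-1)) => m.
have vC r a : v ^+ r * lconst a = lconst a * v ^+ r.
  by apply/commr_sym/commrX/commr_sym/inv_central.
have eP : bracket (lconst y) (subst_psum m.+2)
    = \sum_(k < m.+1) (lconst (c k) * v ^+ k.+1) * subst_psum (m.+1 - k).
  rewrite bracket_psum big_ord_recl /= y0 raddf0 mul0r add0r.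
  under [RHS]eq_bigr => k _ do rewrite subSn -1?ltnS // mulr_sumr.
  pose G k l := lconst (c k) * v ^+ k.+1 * (lconst (c l) * v ^+ l.+1).
  rewrite [RHS](triangle_sum G); apply: eq_bigr => n _.
  rewrite yc raddf_sum mulr_suml; apply: eq_bigr => k _ /=.
  rewrite /G rmorphM -!mulrA (mulrA (v ^+ _)) vC -mulrA -exprD.
  congr (_ * (_ * v ^+ _)).
  by rewrite /bump leq0n addSn addnS subnKC // -ltnS.
rewrite -[X in bracket _ X](subrK (subst_psum m.+2)) bracketDr eP.
(* S^2 is compared with the triangular part a + b <= m of its double sum. *)
have -> : S ^+ 2 = (S - subst_psum m.+1) * S
    + \sum_(k < m.+1) (lconst (c k) * v ^+ k.+1) * (S - subst_psum (m.+1 - k))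
    + \sum_(k < m.+1) (lconst (c k) * v ^+ k.+1) * subst_psum (m.+1 - k).
  rewrite -addrA -big_split /= mulrBl -[LHS](subrK (subst_psum m.+1 * S)).
  rewrite expr2; congr (_ + _); rewrite mulr_suml; apply: eq_bigr => k _.
  by rewrite -mulrDr subrK.
rewrite opprD addrA addrAC addrK; apply: deg_leB.
  by apply: deg_le_bracket; apply: deg_leW (@hS m.+2); lia.
apply: deg_leD.
  by apply: deg_leW (deg_leM (@hS m.+1) subst_deg); lia.
apply: deg_le_sum => k _.
apply: (deg_leW _ (deg_leM (deg_leM (deg_le_const _) (deg_leX v_deg)) (@hS _))).
by have := ltn_ord k; lia.
Qed.
End SubstSeries.

(** * Relations in the Yangian *)

Section AlgebraRelations.
Variables (K : fieldType) (A : algType K).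

Lemma bracketZr (a b : A) (c : K) : bracket a (c *: b) = c *: bracket a b.
Proof. by rewrite /bracket -scalerAl -scalerAr scalerBr. Qed.

Lemma bracketZl (a b : A) (c : K) : bracket (c *: a) b = c *: bracket a b.
Proof. by rewrite /bracket -scalerAl -scalerAr scalerBr. Qed.

(** Subtracting h/2 xi_0^2 from xi_1 removes exactly the anticommutator from the
    relation between xi_1 and x_r, so t_1 shifts the index of x_r. *)
Lemma bracket_t1_x (two0 : (2 : K) != 0) (h : K) (xi0 xi1 y y' : A) (k : int) :
  bracket xi0 y = y *~ (2 * k) ->
  bracket xi1 y = y' *~ (2 * k) + (k%:~R * h) *: (xi0 * y + y * xi0) ->
  bracket (xi1 - (h / 2) *: xi0 ^+ 2) y = y' *~ (2 * k).
Proof.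
move=> h0 h1.
have h2 : bracket (xi0 ^+ 2) y = (2 * k%:~R) *: (xi0 * y + y * xi0).
  by rewrite expr2 bracketMl h0 mulrzAl mulrzAr -mulrzDl -scaler_int intrM.
have cancel (e : K) : e * h + - (h / 2) * (2 * e) = 0.
  by rewrite mulNr mulrA divfK // mulrC subrr.
rewrite bracketDl -scaleNr bracketZl h1 h2 scalerA.
by rewrite -addrA -scalerDl cancel scale0r addr0.
Qed.

(** Adding the relations with r + s = n, the left-hand sides telescope to
    -2 [x_0, x_(n+1)] and the anticommutators pair up. *)
Lemma bracket_quadratic (two0 : (2 : K) != 0) (e : K) (x : nat -> A) :
  (forall r s, bracket (x r.+1) (x s) - bracket (x r) (x s.+1)
     = e *: (x r * x s + x s * x r)) ->
  forall n, bracket (x 0) (x n.+1) = (- e) *: \sum_(a < n.+1) x a * x (n - a)%N.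
Proof.
move=> rel n; pose f r := bracket (x r) (x (n.+1 - r)%N).
have tel : \sum_(r < n.+1) (f r.+1 - f r) = f n.+1 - f 0%N.
  by rewrite -(big_mkord xpredT (fun r => f r.+1 - f r)) telescope_sumr.
have {tel} : f n.+1 - f 0%N
    = e *: ((\sum_(a < n.+1) x a * x (n - a)%N) *+ 2).
  rewrite -tel mulr2n [X in _ *: (_ + X)](reindex_inj rev_ord_inj) /=.
  rewrite -big_split scaler_sumr; apply: eq_bigr => r _ /=.
  have rn : (r <= n)%N by rewrite -ltnS.
  by rewrite subSS subKn // /f subSS subSn.
rewrite /f subnn subn0 [X in X - _]bracketC -opprD -mulr2n => h.
apply: (scalerI two0); rewrite scaler_nat -[LHS]opprK h scalerA.
by rewrite -scaler_nat scalerA mulrN mulrC scaleNr.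
Qed.

Lemma bracket_scaled_quadratic (two0 : (2 : K) != 0) (e : K) (x : nat -> A) :
  (forall r s, bracket (x r.+1) (x s) - bracket (x r) (x s.+1)
     = e *: (x r * x s + x s * x r)) ->
  forall n, bracket (x 0) (- e *: x n.+1)
    = \sum_(a < n.+1) (- e *: x a) * (- e *: x (n - a)%N).
Proof.
move=> rel n; rewrite bracketZr (bracket_quadratic two0 rel) scalerA scaler_sumr.
by apply: eq_bigr => a _; rewrite -scalerAl -scalerAr scalerA.
Qed.
End AlgebraRelations.

Section PresentedRelations.
Variables (K : fieldType) (hbar : K) (F : algType K).
Variables (xi : nat -> F) (x : bool -> nat -> F).
Let Rel := yangian_relator hbar xi x.
Let P : {rmorphism F -> presented_alg Rel} := ppi Rel.

Let ppi_eq0 w : Rel w -> P w = 0.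
Proof. by move=> hw; rewrite /P /= (ppi_rel (v := 0)) ?subr0 // raddf0. Qed.
Let ppiZ (c : K) w : P (c *: w) = c *: P w.
Proof. by rewrite /P /= linearZ. Qed.

Lemma presented_xi0_x b r :
  bracket (P (xi 0)) (P (x b r)) = ((-1) ^+ b * 2) *: P (x b r).
Proof.
have := ppi_eq0 (rel_xi0_x hbar xi x b r).
by rewrite rmorphB bracket_morph ppiZ => /eqP; rewrite subr_eq0 => /eqP.
Qed.

Lemma presented_xi_x b r s :
  bracket (P (xi r.+1)) (P (x b s)) - bracket (P (xi r)) (P (x b s.+1))
    = ((-1) ^+ b * hbar) *: (P (xi r) * P (x b s) + P (x b s) * P (xi r)).
Proof.
have := ppi_eq0 (rel_xi_x hbar xi x b r s).
rewrite 2!rmorphB !bracket_morph ppiZ rmorphD !rmorphM.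
by move/eqP; rewrite subr_eq0 => /eqP.
Qed.

Lemma presented_x_x b r s :
  bracket (P (x b r.+1)) (P (x b s)) - bracket (P (x b r)) (P (x b s.+1))
    = ((-1) ^+ b * hbar) *: (P (x b r) * P (x b s) + P (x b s) * P (x b r)).
Proof.
have := ppi_eq0 (rel_x_x hbar xi x b r s).
rewrite 2!rmorphB !bracket_morph ppiZ rmorphD !rmorphM.
by move/eqP; rewrite subr_eq0 => /eqP.
Qed.
End PresentedRelations.

Section YangianRelations.
Variables (K : fieldType) (hbar : K).
Local Notation Y := (yangian hbar).
Hypothesis two0 : (2 : K) != 0.
Local Notation sg b := ((-1) ^+ b : int).

Lemma signzK b : (sg b)%:~R = (-1) ^+ b :> K.
Proof. by rewrite rmorph_sign. Qed.

Lemma yxi0_x b r : bracket (yxi hbar 0) (yx hbar b r) = yx hbar b r *~ (2 * sg b).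
Proof.
rewrite -scaler_int intrM signzK mulrC.
exact: (presented_xi0_x hbar (@free_xi K) (@free_x K)).
Qed.

Lemma yxi1_x b r : bracket (yxi hbar 1) (yx hbar b r)
    - bracket (yxi hbar 0) (yx hbar b r.+1)
  = ((-1) ^+ b * hbar) *:
      (yxi hbar 0 * yx hbar b r + yx hbar b r * yxi hbar 0).
Proof. exact: (presented_xi_x hbar (@free_xi K) (@free_x K)). Qed.

Lemma yx_x_shift b r n : bracket (yx hbar b r.+1) (yx hbar b n)
    - bracket (yx hbar b r) (yx hbar b n.+1)
  = ((-1) ^+ b * hbar) *:
      (yx hbar b r * yx hbar b n + yx hbar b n * yx hbar b r).
Proof. exact: (presented_x_x hbar (@free_xi K) (@free_x K)). Qed.

Lemma yt1_x b r : bracket (t1 hbar) (yx hbar b r) = yx hbar b r.+1 *~ (2 * sg b).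
Proof.
apply: (@bracket_t1_x _ _ two0 hbar (yxi hbar 0) (yxi hbar 1)); first exact: yxi0_x.
by rewrite -yxi0_x signzK -yxi1_x addrC subrK.
Qed.

(** In terms of c x_r, which are the coefficients of x^-(u) and of -x^+(u), the
    two signs of the quadratic relation coincide. *)
Lemma yx_scaled_quadratic (b : bool) (c : K) n : - ((-1) ^+ b * hbar) = c ->
  bracket (yx hbar b 0) (c *: yx hbar b n.+1)
  = \sum_(a < n.+1) (c *: yx hbar b a) * (c *: yx hbar b (n - a)%N).
Proof. move=> <-; exact: (bracket_scaled_quadratic two0 (yx_x_shift b) n). Qed.

End YangianRelations.

(** * The currents *)

Lemma lcoef_sum (A : zmodType) (I : Type) (r : seq I) (P : pred I)
    (F : I -> laurent A) i :
  (\sum_(k <- r | P k) F k) i = \sum_(k <- r | P k) F k i.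
Proof. by elim/big_rec2: _ => // k a f _ <-; rewrite lcoefD. Qed.

Section CurrentsAsSubst.
Variables (K : fieldType) (A : algType K) (hbar : K) (x : nat -> A).

Lemma lconstZl c (a : A) (f : laurent A) : lconst (c *: a) * f = c *: (lconst a * f).
Proof. by apply/laurentP => i; rewrite lcoefZ !lmonoMl scalerAl. Qed.

Lemma int_cases (i : int) : 0 < i \/ exists m : nat, i = - m%:Z.
Proof. by have [i0|i0] := ltP 0 i; [left|right; exists (absz i); lia]. Qed.

Lemma xser_subst : is_subst (lmono (-1) 1) (fun r => hbar *: x r) (xser hbar x).
Proof.
move=> N i Ni; rewrite lcoefB lcoef_sum.
have vX r : lmono (-1) 1 ^+ r = lmono (- r%:Z) 1 :> laurent A.
  elim: r => [|r IH]; first by rewrite expr0 oppr0.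
  by rewrite exprS IH lmonoM mulr1; congr lmono; lia.
have vE r : (lconst (hbar *: x r) * lmono (-1) 1 ^+ r.+1) i
    = if i == - r.+1%:Z then hbar *: x r else 0.
  by rewrite vX lmonoM mulr1 add0r.
under eq_bigr => r _ do rewrite vE.
have [i0|[m im]] := int_cases i.
  by rewrite lser_gt0 // big1 ?subr0 // => r _; rewrite ifF //; lia.
rewrite im lserN; case: m im => [|m] im.
  by rewrite big1 ?subr0 // => r _; rewrite ifF //; lia.
have mN : (m < N)%N by lia.
rewrite (bigD1 (Ordinal mN)) //= eqxx big1 ?addr0 ?subrr // => r rm.
by rewrite ifF //; apply: contraNF rm => /eqP h; apply/eqP/val_inj => /=; lia.
Qed.

Lemma inv_u_sub_s_deg : deg_le (-1) (inv_u_sub_s A).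
Proof.
move=> j j1; have [j0|->] : 0 < j \/ j = - 0%:Z by lia.
  exact: lser_gt0.
exact: lserN.
Qed.

Definition u_sub_s : laurent (laurent A) := lconst (lmono 1 1) - lmono 1 1.

Lemma xshift_subst :
  is_subst (inv_u_sub_s A) (fun r => lconst (hbar *: x r)) (xshift hbar x).
Proof.
move=> N i Ni; rewrite lcoefB lcoef_sum.
under eq_bigr => r _ do rewrite lmonoMl subr0 lconstZl.
have vanish (r : nat) (j : int) : - r.+1%:Z < j ->
    hbar *: (lconst (x r) * (inv_u_sub_s A ^+ r.+1) j) = 0.
  by move=> rj; rewrite (deg_leX inv_u_sub_s_deg) ?mulr0 ?scaler0.
have [i0|[m im]] := int_cases i.
  by rewrite lser_gt0 // big1 ?subr0 // => r _; apply: vanish; lia.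
have {Ni} mN : (m <= N)%N by lia.
rewrite im lserN -(subnK mN) addnC big_split_ord /= [X in _ - (_ + X)]big1.
  by rewrite addr0 subrr.
by move=> r _; apply: vanish; lia.
Qed.

Lemma u_sub_s_central : central u_sub_s.
Proof.
have c1 : central (1 : A) by move=> a; rewrite mul1r mulr1.
have c1' : central (1 : laurent A) by move=> a; rewrite mul1r mulr1.
move=> f; rewrite mulrBl mulrBr; congr (_ - _); apply: central_lmono => //.
exact: central_lmono.
Qed.

Lemma u_sub_s_deg : deg_le 1 u_sub_s.
Proof.
apply: deg_leB; last exact: deg_le_mono.
by move=> i i1; apply: deg_le_const; lia.
Qed.

(** The property behind the vanishing of the residue of x^-(u-s). *)
Definition u_poly (f : laurent (laurent A)) := forall i j : int, j < 0 -> f i j = 0.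

Lemma u_polyM f g : u_poly f -> u_poly g -> u_poly (f * g).
Proof.
move=> hf hg i; pose P (a : laurent A) := forall j : int, j < 0 -> a j = 0.
refine (@lcoef_mul_ind _ P f g _ _ _ i); rewrite /P.
- by [].
- by move=> a b ha hb j j0; rewrite lcoefD ha ?hb ?addr0.
move=> k l j j0; rewrite lcoefM; apply: fsbig1 => n _.
have [n0|n0] := ltP n 0; first by rewrite hf ?mul0r.
by rewrite hg ?mulr0 //; lia.
Qed.

Lemma inv_u_sub_s_poly : u_poly (inv_u_sub_s A).
Proof.
move=> i j j0; have [i0|[m ->]] := int_cases i; first by rewrite lser_gt0.
rewrite lserN; case: m => [//|m]; rewrite lcoefN /= ifF ?oppr0 //; lia.
Qed.

Lemma xshift_poly : u_poly (xshift hbar x).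
Proof.
have vP r : u_poly (inv_u_sub_s A ^+ r).
  elim: r => [|r IH].
    move=> i j j0; rewrite expr0 /=; case: ifP => //= _.
    by rewrite ifF //; lia.
  by rewrite exprS; apply: u_polyM IH; apply: inv_u_sub_s_poly.
move=> i j j0; have [i0|[m ->]] := int_cases i; first by rewrite lser_gt0.
rewrite lserN lcoef_sum big1 // => r _.
by rewrite lcoefZ lmonoMl vP ?mulr0 ?scaler0 //; lia.
Qed.

End CurrentsAsSubst.

(** * Tensor products and ordered exponentials *)

Section LaurentComm.
Variable A : pzRingType.
Lemma laurent_comm (f g : laurent A) :
  (forall i j, GRing.comm (f i) (g j)) -> GRing.comm f g.
Proof.
move=> fg; apply/laurentP => i.
have [M hM] := lcoef_bound f; have [N Ni hN] := lcoef_boundW g (i - M).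
have [m im] : exists m : nat, i = M + N - m%:Z.
  by exists (absz (M + N - i)%R); lia.
rewrite im [LHS](lmul_coefE _ hM hN) (addrC M) [RHS](lmul_coefE _ hN hM).
rewrite (reindex_inj rev_ord_inj); apply: eq_bigr => k _ /=.
by rewrite subSS subKn -1?ltnS // fg.
Qed.
End LaurentComm.

Section TensorScale.
Variables (K : fieldType) (A : algType K).
Local Notation T := (tensor A A).

Lemma tensor_scalerAl (c : K) (f g : T) : c *: (f * g) = (c *: f) * g.
Proof. exact: presented_scalerAl. Qed.
Lemma tensor_scalerAr (c : K) (f g : T) : c *: (f * g) = f * (c *: g).
Proof. exact: presented_scalerAr. Qed.

Lemma lconst_scale (c : K) (f : laurent T) : lconst (c *: (1 : T)) * f = c *: f.
Proof. by apply/laurentP => i; rewrite lmonoMl -tensor_scalerAl mul1r subr0. Qed.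
Lemma central_scale (c : K) : central (lconst (c *: (1 : T))).
Proof.
by apply: central_lmono => f; rewrite -tensor_scalerAl -tensor_scalerAr mulr1 mul1r.
Qed.
Lemma laurent_scalerAl (c : K) (f g : laurent T) : c *: (f * g) = (c *: f) * g.
Proof. by rewrite -!lconst_scale mulrA. Qed.
Lemma laurent_scalerAr (c : K) (f g : laurent T) : c *: (f * g) = f * (c *: g).
Proof. by rewrite -!lconst_scale mulrA central_scale -mulrA. Qed.
Lemma laurent_bracketZr (c : K) (f g : laurent T) :
  bracket f (c *: g) = c *: bracket f g.
Proof. by rewrite /bracket -laurent_scalerAl -laurent_scalerAr -scalerBr. Qed.
Lemma laurent_bracketZl (c : K) (f g : laurent T) :
  bracket (c *: f) g = c *: bracket f g.
Proof. by rewrite /bracket -laurent_scalerAl -laurent_scalerAr -scalerBr. Qed.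
End TensorScale.

(** [Rterm] lists the coefficients of the ordered exponential of [om]. *)
Section Exponential.
Variables (L : pzRingType) (S b : L) (om Rterm : nat -> L).
Hypothesis mulrn_inj : forall n (f g : L), f *+ n.+1 = g *+ n.+1 -> f = g.
Hypotheses (Rterm0 : Rterm 0 = 1)
  (RtermS : forall n, Rterm n.+1 *+ n.+1 = \sum_(k < n.+1) Rterm k * om (n.+1 - k)%N).
Hypotheses (om1 : bracket S (om 1) = - b)
  (omS : forall k, bracket S (om k.+2) = - bracket (om k.+1) b).

(** Apply the derivation [bracket S] to (n+1) R_(n+1) = sum_k R_k w_(n+1-k). By
    induction and the relations for w, the terms regroup as
    - sum_j R_j w_(n-j) b - R_n b = - (n+1) R_n b. *)
Lemma bracket_Rterm n : bracket S (Rterm n.+1) = - (Rterm n * b).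
Proof.
elim/ltn_ind: n => n IH; apply: (@mulrn_inj n).
rewrite -bracketMn RtermS bracket_sum.
under eq_bigr => k _ do rewrite bracketMr.
rewrite big_split /= big_ord_recl Rterm0 bracket1 mul0r add0r.
rewrite [X in _ + X]big_ord_recr /= subSnn om1 mulrN addrA -big_split /=.
rewrite (eq_bigr (fun k : 'I_n => - (Rterm k * om (n - k)%N) * b)) => [|k _].
  rewrite -mulr_suml sumrN mulNr -opprD mulNrn; congr (- _).
  case: n {IH} => [|n]; first by rewrite big_ord0 mul0r add0r.
  by rewrite -RtermS mulrnAl -mulrSr.
have nk : (n.+1 - k = (n - k.+1).+2)%N by have := ltn_ord k; lia.
have nk' : (n - k = (n - k.+1).+1)%N by have := ltn_ord k; lia.
rewrite (_ : bump 0 k = k.+1) // subSS nk nk' omS IH // mulrN mulNr mulNr.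
by rewrite -opprD /bracket mulrBr !mulrA addrC subrK.
Qed.
End Exponential.

(** * The commutation relations of the residues *)

Lemma lcoefMz (B : zmodType) (f : laurent B) (n : int) i : (f *~ n) i = f i *~ n.
Proof.
have hn m : (f *+ m) i = f i *+ m.
  by elim: m => [|m IH] //; rewrite !mulrS lcoefD IH.
by case: n => m; rewrite ?NegzE ?mulrNz -?pmulrn ?lcoefN hn.
Qed.

Lemma recombine_tau (L : pzRingType) (u s h z y : L) :
  ((u - s) * z - h * y) *~ (-2) + s * (z *~ (-2)) = - (u *+ 2) * z + (h *+ 2) * y.
Proof.
rewrite !mulrNz mulrN mulrnAr -opprD -mulrnDl mulrBl addrAC subrK.
by rewrite mulrnBl opprB mulNr !mulrnAl addrC.
Qed.

Lemma lmap_lmono (B C : zmodType) (f : {additive B -> C}) n b :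
  lmap f (lmono n b) = lmono n (f b).
Proof. by apply/laurentP => i /=; case: ifP => _ //; rewrite raddf0. Qed.

Lemma lmap_lconst (B C : zmodType) (f : {additive B -> C}) b :
  lmap f (lconst b) = lconst (f b).
Proof. exact: lmap_lmono. Qed.

Lemma central1 (B : pzRingType) : central (1 : B).
Proof. by move=> a; rewrite mul1r mulr1. Qed.

Lemma lmono1_inv (B : pzRingType) : lmono 1 1 * lmono (-1) 1 = 1 :> laurent B.
Proof. by rewrite lmonoM mulr1. Qed.

Section CurrentWeights.
Variables (K : fieldType) (hbar : K) (A : algType K) (x : nat -> A).
Variables (xi0 : A) (c : int).
Hypothesis xi0_x : forall r, bracket xi0 (hbar *: x r) = (hbar *: x r) *~ c.

Lemma bracket_xi0_xser : bracket (lconst xi0) (xser hbar x) = xser hbar x *~ c.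
Proof.
exact: (bracket_subst_scale (central_lmono 1 (@central1 A))
  (@lmono1_inv A) (xser_subst _ _)).
Qed.

Lemma bracket_xi0_xshift :
  bracket (lconst (lconst xi0)) (xshift hbar x) = xshift hbar x *~ c.
Proof.
apply: (bracket_subst_scale (@u_sub_s_central _ A)
  (@inv_u_sub_sP _ A) (xshift_subst _ _)) => r.
by rewrite -bracket_morph xi0_x raddfMz.
Qed.

Lemma xser_weight k i :
  bracket xi0 ((xser hbar x ^+ k) i) = (xser hbar x ^+ k) i *~ (c * k%:Z).
Proof.
by rewrite -bracket_lconst (bracket_exp_scalar k bracket_xi0_xser) lcoefMz.
Qed.

Lemma xshift_weight k i j :
  bracket xi0 ((xshift hbar x ^+ k) i j) = (xshift hbar x ^+ k) i j *~ (c * k%:Z).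
Proof.
by rewrite -!bracket_lconst (bracket_exp_scalar k bracket_xi0_xshift) !lcoefMz.
Qed.
End CurrentWeights.

(** The target ring T stands for A ⊗ A, with the embeddings phi and psi of the two
    factors and the scalar hbar as a central element h. *)
Section OmegaRelations.
Variables (K : fieldType) (hbar : K) (A : algType K).
Variables (t xi0 : A) (xp xm : nat -> A).
Variables (T : pzRingType) (phi psi : {rmorphism A -> T}) (h : T).
Hypothesis h_central : central h.
Hypothesis phi_psi : forall a b, GRing.comm (phi a) (psi b).
Hypothesis phi_h : forall a, phi (hbar *: a) = h * phi a.
Hypothesis psi_h : forall a, psi (hbar *: a) = h * psi a.
Local Notation xpc r := (- hbar *: xp r).
Local Notation xmc r := (hbar *: xm r).
Hypothesis xi0_m : forall r, bracket xi0 (xmc r) = xmc r *~ (-2).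
Hypothesis t_p : forall r, bracket t (xpc r) = xpc r.+1 *~ 2.
Hypothesis t_m : forall r, bracket t (xmc r) = xmc r.+1 *~ (-2).
Hypothesis x_p : forall n,
  bracket (xp 0) (xpc n.+1) = \sum_(a < n.+1) xpc a * xpc (n - a)%N.
Hypothesis x_m : forall n,
  bracket (xm 0) (xmc n.+1) = \sum_(a < n.+1) xmc a * xmc (n - a)%N.

Let Z : laurent (laurent A) := xshift hbar xm.
(* The current -x^+(u); its sign absorbs the factor (-1)^k of omega. *)
Let X : laurent A := xser (- hbar) xp.

Let X_subst : is_subst (lmono (-1) 1) (fun r => xpc r) X.
Proof. exact: xser_subst. Qed.
Let Z_subst : is_subst (inv_u_sub_s A) (fun r => lconst (xmc r)) Z.
Proof. exact: xshift_subst. Qed.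

Let bracket_xX : bracket (lconst (xp 0)) X = X ^+ 2.
Proof.
apply: (bracket_subst_square (central_lmono 1 (@central1 A))
  (@deg_le_mono _ (-1) 1) (@lmono1_inv A) X_subst) => // .
by rewrite bracketZr /bracket subrr scaler0.
Qed.

Let bracket_tX :
  bracket (lconst t) X = (lmono 1 1 * X - lconst (xpc 0)) *~ 2.
Proof.
apply: (bracket_subst_shift (central_lmono 1 (@central1 A))
  (@deg_le_mono _ 1 1) (@lmono1_inv A) X_subst); exact: t_p.
Qed.

Let bracket_yZ : bracket (lconst (lconst (xm 0))) Z = Z ^+ 2.
Proof.
apply: (bracket_subst_square (@u_sub_s_central _ A)
  (@inv_u_sub_s_deg _ A) (@inv_u_sub_sP _ A) Z_subst) => [|n].
  by rewrite -bracket_morph bracketZr /bracket subrr scaler0 raddf0.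
rewrite -bracket_morph x_m raddf_sum; apply: eq_bigr => a _; exact: rmorphM.
Qed.

Let bracket_tZ : bracket (lconst (lconst t)) Z
  = (u_sub_s A * Z - lconst (lconst (xmc 0))) *~ (-2).
Proof.
apply: (bracket_subst_shift (@u_sub_s_central _ A) (@u_sub_s_deg _ A)
  (@inv_u_sub_sP _ A) Z_subst) => r.
by rewrite -bracket_morph t_m raddfMz.
Qed.

Let bracket_xiZ : bracket (lconst (lconst xi0)) Z = Z *~ (-2).
Proof. exact: bracket_xi0_xshift. Qed.

Let TL : {rmorphism laurent (laurent A) -> laurent (laurent T)} :=
  lmap (lmap phi).
Let TR : {rmorphism laurent A -> laurent (laurent T)} :=
  @lconst (laurent T) \o lmap psi.

Let TLc a : TL (lconst (lconst a)) = lconst (lconst (phi a)).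
Proof. by rewrite /TL /= lmap_lconst /= lmap_lconst. Qed.
Let TRc a : TR (lconst a) = lconst (lconst (psi a)).
Proof. by rewrite /TR /= lmap_lconst. Qed.

Let comm_TLR f g : GRing.comm (TL f) (TR g).
Proof.
apply: laurent_comm => i j; rewrite /TR /=; case: ifP => _; last first.
  by rewrite /GRing.comm mulr0 mul0r.
by apply: laurent_comm => k l /=; exact: phi_psi.
Qed.

Definition std_coprod : laurent T := lconst (phi t + psi t) + lmono 1 (phi xi0).

Let y' := TL (lconst (lconst (xm 0))).
Let x' := TR (lconst (xp 0)).
Let s : laurent (laurent T) := lmono 1 1.
Let u : laurent (laurent T) := lconst (lmono 1 1).
Let tau := TL (lconst (lconst t)) + s * TL (lconst (lconst xi0)).
Let sigma := TR (lconst t).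
Let h' : laurent (laurent T) := lconst (lconst h).

Let std_lift : lmap (@lconst T) std_coprod = tau + sigma.
Proof.
rewrite /std_coprod /tau /sigma TRc !TLc /s lmonoM mul1r addr0.
by rewrite !raddfD /= !lmap_lconst lmap_lmono addrAC.
Qed.

Let u_TR : TR (lmono 1 1) = u.
Proof. by rewrite /TR /= lmap_lmono /= rmorph1. Qed.

Let us_TL : TL (u_sub_s A) = u - s.
Proof.
rewrite /u_sub_s /u /s (rmorphB TL) /TL /= lmap_lconst !lmap_lmono /= lmap_lmono /= rmorph1.
by rewrite (rmorph1 (lmap phi)).
Qed.

Let s_central : central s. Proof. exact: (central_lmono 1 (@central1 _)). Qed.
Let h'_central : central h'.
Proof. by do 2!apply: central_lmono. Qed.
Let u_central : central u.
Proof. apply: central_lmono; exact: (central_lmono 1 (@central1 _)). Qed.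

(* The term s xi_0 of tau turns u - s into u. *)
Let tauZ : bracket tau (TL Z) = - (u *+ 2) * TL Z + (h' *+ 2) * y'.
Proof.
have sxi : bracket (s * TL (lconst (lconst xi0))) (TL Z)
    = s * bracket (TL (lconst (lconst xi0))) (TL Z).
  by rewrite bracketMl (bracket_comm (s_central _)) mul0r addr0.
rewrite /tau bracketDl sxi -!bracket_morph bracket_tZ bracket_xiZ.
rewrite !(rmorphMz TL) (rmorphB TL) (rmorphM TL) us_TL.
have -> : TL (lconst (lconst (xmc 0))) = h' * y'.
  by rewrite /h' /y' !TLc phi_h !rmorphM.
exact: recombine_tau.
Qed.

Let sigmaX : bracket sigma (TR X) = (u *+ 2) * TR X + (h' *+ 2) * x'.
Proof.
rewrite /sigma -bracket_morph bracket_tX (rmorphMz TR) (rmorphB TR).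
rewrite (rmorphM TR) u_TR.
have -> : TR (lconst (xpc 0)) = - (h' * x').
  by rewrite /h' /x' !TRc scaleNr raddfN /= psi_h !raddfN /= !rmorphM.
by rewrite opprK mulrzDl -!pmulrn !mulrnAl.
Qed.

Definition omega_res k : laurent T := lmap (@residue T) (pair_pow (TL Z) (TR X) k).

Lemma omega_resE k : omega_res k = (-1) ^+ k * lmap (@residue T)
  (lmap (lmap phi) (xshift hbar xm ^+ k) * lconst (lmap psi (xser hbar xp ^+ k))).
Proof.
rewrite /omega_res /pair_pow -(rmorphXn TL) -(rmorphXn TR).
have -> : X = - xser hbar xp.
  by apply/laurentP => i; rewrite lcoefN /X /=; case: ifP => _; rewrite ?oppr0 //;
    case: absz => [|n]; rewrite ?oppr0 // scaleNr.
rewrite [in LHS]exprNn -[in LHS]signr_odd -[in RHS]signr_odd.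
case: odd; last by rewrite !expr0 !mul1r.
by rewrite !expr1 !mulN1r (rmorphN TR) mulrN raddfN.
Qed.

Definition omega_cross k : laurent T :=
  lmap (@residue T) (pair_cross y' (TL Z) x' (TR X) k).

Let yZ' : bracket y' (TL Z) = TL Z ^+ 2.
Proof. by rewrite /y' -bracket_morph bracket_yZ rmorphXn. Qed.
Let xX' : bracket x' (TR X) = TR X ^+ 2.
Proof. by rewrite /x' -bracket_morph bracket_xX rmorphXn. Qed.

Let h2_lift : h' *+ 2 = lmap (@lconst T) (lconst h *+ 2).
Proof. by rewrite raddfMn /= lmap_lconst. Qed.

Lemma bracket_std_omega k : bracket std_coprod (omega_res k.+1)
  = ((lconst h *+ 2) * omega_cross k) *+ k.+1.
Proof.
rewrite /omega_res -bracket_residue std_lift.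
have c2 (c : laurent (laurent T)) : central c -> central (c *+ 2).
  by move=> cc f; rewrite mulrnAl mulrnAr cc.
have tauX : GRing.comm tau (TR X).
  apply/commr_sym/commrD; first exact/commr_sym/comm_TLR.
  by apply: commrM; apply: commr_sym; [exact: s_central|exact: comm_TLR].
rewrite (bracket_pair_pow yZ' xX' k (c2 _ u_central)
  (c2 _ h'_central) tauX (commr_sym (comm_TLR _ _)) tauZ sigmaX).
by rewrite raddfMn /= h2_lift residueMl.
Qed.

Lemma bracket_omega_corner k :
  bracket (omega_res k) (lconst (phi (xm 0) * psi (xp 0))) = - (omega_cross k *+ k).
Proof.
rewrite bracketC /omega_res -bracket_residue.
have -> : lmap (@lconst T) (lconst (phi (xm 0) * psi (xp 0))) = y' * x'.
  by rewrite lmap_lconst /y' /x' TLc TRc /= !rmorphM.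
rewrite -raddfN -bracketC (bracket_pair_corner (comm_TLR _ _)
  (comm_TLR _ _) yZ' xX').
by rewrite raddfN raddfMn.
Qed.

(** The only place where the residue is evaluated: Z contributes nothing, and
    the residue of X is - hbar x_0^+. *)
Lemma omega_cross0 : omega_cross 0 = - lconst (h * (phi (xm 0) * psi (xp 0))).
Proof.
rewrite /omega_cross /pair_cross !expr0 !expr1 !mulr1 mulr0n subr0 raddfD /=.
have -> : y' = lmap (@lconst T) (lconst (phi (xm 0))).
  by rewrite lmap_lconst /y' TLc.
have -> : x' = lmap (@lconst T) (lconst (psi (xp 0))).
  by rewrite lmap_lconst /x' TRc.
rewrite residueMl residueMr.
have -> : lmap (@residue T) (TL Z) = 0.
  apply/laurentP => i; rewrite /residue /=.
  by rewrite /Z xshift_poly // raddf0.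
have -> : lmap (@residue T) (TR X) = lconst (psi (- hbar *: xp 0)).
  rewrite /TR /= lmap_lconst; congr lconst.
rewrite mul0r addr0 -rmorphM scaleNr !raddfN /= psi_h mulrN raddfN /=.
by rewrite !mulrA h_central.
Qed.

End OmegaRelations.

(** * Residues in the tensor product *)

Lemma sign_mulE (L : pzRingType) (f : L) k :
  (-1) ^+ k * f = if odd k then - f else f.
Proof.
by rewrite -signr_odd; case: odd; rewrite ?expr1 ?expr0 ?mulN1r ?mul1r.
Qed.

Lemma sign_scaleE (K : fieldType) (V : lmodType K) (c : K) (f : V) k :
  ((-1) ^+ k / c) *: f = if odd k then - (c^-1 *: f) else c^-1 *: f.
Proof.
by rewrite sign_mulE; case: odd; rewrite ?scaleNr.
Qed.

Section OmegaTensor.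
Variables (K : fieldType) (hbar : K) (A : algType K).
Variables (t xi0 : A) (xp xm : nat -> A).
Local Notation T := (tensor A A).
Local Notation xpc r := (- hbar *: xp r).
Local Notation xmc r := (hbar *: xm r).
Hypothesis hbar_neq0 : hbar != 0.
Hypothesis natK : forall n, (n.+1%:R : K) != 0.
Hypothesis xi0_p : forall r, bracket xi0 (hbar *: xp r) = (hbar *: xp r) *~ 2.
Hypothesis xi0_m : forall r, bracket xi0 (xmc r) = xmc r *~ (-2).
Hypothesis t_p : forall r, bracket t (xpc r) = xpc r.+1 *~ 2.
Hypothesis t_m : forall r, bracket t (xmc r) = xmc r.+1 *~ (-2).
Hypothesis x_p : forall n,
  bracket (xp 0) (xpc n.+1) = \sum_(a < n.+1) xpc a * xpc (n - a)%N.
Hypothesis x_m : forall n,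
  bracket (xm 0) (xmc n.+1) = \sum_(a < n.+1) xmc a * xmc (n - a)%N.

(** [omega] over an arbitrary algebra with currents. *)
Definition tensor_omega (k : nat) : laurent T :=
  ((-1) ^+ k / (k%:R * hbar)) *: lmap (@residue T)
    (lmap (lmap (@tensl K A A)) (xshift hbar xm ^+ k)
       * lconst (lmap (@tensr K A A) (xser hbar xp ^+ k))).

Let h : T := hbar *: (1 : T).
Let std : laurent T := std_coprod t xi0 (@tensl K A A) (@tensr K A A).
Let corner : T := tens (xm 0) (xp 0).
Let cross := omega_cross hbar xp xm (@tensl K A A) (@tensr K A A).
Let res := omega_res hbar xp xm (@tensl K A A) (@tensr K A A).

Let h_central : central h.
Proof.
by move=> f; rewrite /h -tensor_scalerAl -tensor_scalerAr mulr1 mul1r.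
Qed.
Let tens_comm a b : GRing.comm (tensl A a) (tensr A b).
Proof. by rewrite /GRing.comm /tensl /tensr !tensM !mulr1 !mul1r. Qed.
Let tensl_h a : tensl A (hbar *: a) = h * tensl A a.
Proof. by rewrite /h -tensor_scalerAl mul1r /tensl tensZl. Qed.
Let tensr_h a : tensr A (hbar *: a) = h * tensr A a.
Proof. by rewrite /h -tensor_scalerAl mul1r /tensr tensZr. Qed.

Let omegaE k : tensor_omega k = (k%:R * hbar)^-1 *: res k.
Proof.
rewrite /tensor_omega /res omega_resE sign_scaleE sign_mulE.
by case: odd => //; rewrite scalerN.
Qed.

Let bracket_omegaS k : bracket std (tensor_omega k.+1) = 2 *: cross k.
Proof.
have k1 := natK k.
rewrite omegaE laurent_bracketZr /res /std.
rewrite (bracket_std_omega h_central tens_comm tensl_h tensr_h xi0_m t_p t_m x_p x_m).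
have -> : (lconst h *+ 2) * cross k = (2 * hbar) *: cross k.
  by rewrite [LHS]mulrnAl /h lconst_scale -scaler_nat scalerA.
rewrite -scaler_nat !scalerA; congr (_ *: _).
by rewrite -?mulrA (mulrCA k.+1%:R) (mulrCA _^-1) mulVf ?mulr1 // mulf_neq0.
Qed.

Let bracket_omega_corner1 k :
  bracket (tensor_omega k.+1) (lconst corner) = - (hbar^-1 *: cross k.+1).
Proof.
have k1 := natK k.
rewrite omegaE laurent_bracketZl /res.
have -> : corner = tensl A (xm 0) * tensr A (xp 0).
  by rewrite /tensl /tensr tensM mulr1 mul1r.
rewrite (bracket_omega_corner tens_comm x_p x_m).
by rewrite scalerN -scaler_nat scalerA invfM mulrAC mulVf // mul1r.
Qed.

Lemma bracket_omega1 : bracket std (tensor_omega 1) = - lconst ((2 * hbar) *: corner).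
Proof.
rewrite bracket_omegaS /cross (omega_cross0 _ _ _ h_central tensr_h).
rewrite scalerN; congr (- _); apply/laurentP => i; rewrite lcoefZ /=.
case: ifP => _; last by rewrite scaler0.
by rewrite -tensor_scalerAl mul1r scalerA /tensl /tensr tensM mulr1 mul1r.
Qed.

Lemma bracket_omegaSS k : bracket std (tensor_omega k.+2)
  = - bracket (tensor_omega k.+1) (lconst ((2 * hbar) *: corner)).
Proof.
have -> : lconst ((2 * hbar) *: corner) = (2 * hbar) *: lconst corner.
  by apply/laurentP => i; rewrite lcoefZ /=; case: ifP; rewrite ?scaler0.
rewrite laurent_bracketZr bracket_omega_corner1 scalerN opprK scalerA.
by rewrite mulfK // bracket_omegaS.
Qed.

Definition wt_tens (n : nat) (f : T) := exists s : seq (A * A),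
  (forall p, p \in s -> bracket xi0 p.1 = p.1 *~ (-2 * n%:Z) /\
     bracket xi0 p.2 = p.2 *~ (2 * n%:Z)) /\ f = \sum_(p <- s) tens p.1 p.2.

Lemma tensor_omega_coef k i : tensor_omega k i = ((-1) ^+ k / (k%:R * hbar)) *:
  (lmap (@tensl K A A) ((xshift hbar xm ^+ k) i)
     * lmap (@tensr K A A) (xser hbar xp ^+ k)) (-1).
Proof.
rewrite /tensor_omega lcoefZ; congr (_ *: _).
apply: (congr1 (fun f : laurent T => f (-1))).
by apply: etrans (lmonoMr _ _ _ _) _; rewrite subr0.
Qed.

(** The current x^-(u-s) is O(s^-1); this makes the sum over n converge. *)
Lemma tensor_omega_deg k : deg_le (- k%:Z) (tensor_omega k).
Proof.
move=> i ki; rewrite tensor_omega_coef (deg_leX _ ki) ?raddf0 ?mul0r ?scaler0 //.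
by apply: subst_deg; exact: xshift_subst.
Qed.

Lemma wt_tens0 n : wt_tens n 0.
Proof. by exists [::]; rewrite big_nil. Qed.
Lemma wt_tensD n f g : wt_tens n f -> wt_tens n g -> wt_tens n (f + g).
Proof.
move=> [s [hs ->]] [r [hr ->]]; exists (s ++ r); rewrite big_cat; split=> //.
by move=> p; rewrite mem_cat => /orP[/hs|/hr].
Qed.
Lemma wt_tens1 n a b : bracket xi0 a = a *~ (-2 * n%:Z) ->
  bracket xi0 b = b *~ (2 * n%:Z) -> wt_tens n (tens a b).
Proof.
by move=> ha hb; exists [:: (a, b)]; rewrite big_seq1; split=> // p; rewrite inE => /eqP ->.
Qed.
Lemma wt_tens_sum n (I : Type) (r : seq I) (P : pred I) (F : I -> T) :
  (forall i, P i -> wt_tens n (F i)) -> wt_tens n (\sum_(i <- r | P i) F i).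
Proof.
by move=> hF; elim/big_ind: _ => //; [exact: wt_tens0|exact: wt_tensD].
Qed.
Lemma wt_tensZ n c f : wt_tens n f -> wt_tens n (c *: f).
Proof.
move=> [s [hs ->]]; rewrite scaler_sumr big_seq; apply: wt_tens_sum => p /hs [h1 h2].
rewrite -tensZl; apply: wt_tens1 => //.
by rewrite bracketZr h1 -!scaler_int !scalerA mulrC.
Qed.
Lemma wt_tensM m n f g : wt_tens m f -> wt_tens n g -> wt_tens (m + n) (f * g).
Proof.
move=> [s [hs ->]] [r [hr ->]]; rewrite big_seq mulr_suml; apply: wt_tens_sum => p /hs [p1 p2].
rewrite big_seq mulr_sumr; apply: wt_tens_sum => q /hr [q1 q2].
rewrite tensM; apply: wt_tens1.
  by rewrite bracketMr p1 q1 mulrzAl mulrzAr -mulrzDr PoszD mulrDr.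
by rewrite bracketMr p2 q2 mulrzAl mulrzAr -mulrzDr PoszD mulrDr.
Qed.

Lemma wt_tensor_omega k i : wt_tens k (tensor_omega k i).
Proof.
rewrite tensor_omega_coef; apply: wt_tensZ; apply: lcoef_mul_ind.
- exact: wt_tens0.
- exact: wt_tensD.
move=> j l /=; rewrite /tensl /tensr tensM mulr1 mul1r; apply: wt_tens1.
  exact: xshift_weight.
exact: xser_weight.
Qed.

End OmegaTensor.

(** * Sums over compositions *)

Section Compositions.
Variables (K : fieldType) (A : algType K).
Local Notation T := (tensor A A).
Hypothesis natK : forall n, (n.+1%:R : K) != 0.
Variable om : nat -> laurent T.

Definition comp_weight (k : seq nat) : laurent T :=
  (\prod_(p <- scanl addn 0%N k) (p%:R : K))^-1 *: \prod_(j <- k) om j.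

Definition comp_sum n := \sum_(k \in compositions n) comp_weight k.

Lemma comp_sumE n :
  comp_sum n = \sum_(k <- fset_set (compositions n)) comp_weight k.
Proof. exact/fsbig_finite/finite_compositions. Qed.

Lemma mem_compositions n k :
  (k \in fset_set (compositions n)) = all (leq 1) k && (sumn k == n).
Proof.
rewrite in_fset_set; last exact: finite_compositions.
apply/idP/andP => [/set_mem[-> ->]|[k1 /eqP kn]]; first by rewrite eqxx.
exact/mem_set.
Qed.

Lemma foldl_addn s : foldl addn 0%N s = sumn s.
Proof. by elim/last_ind: s => // s x IH; rewrite foldl_rcons IH sumn_rcons. Qed.

(** The last partial sum of a composition is its total, so appending a part
    divides the coefficient by the new total. *)
Lemma comp_weight_rcons k m : (0 < m)%N ->
  comp_weight (rcons k m) = ((sumn k + m)%:R)^-1 *: (comp_weight k * om m).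
Proof.
move=> m0; rewrite /comp_weight scanl_rcons foldl_addn sumn_rcons.
rewrite -!cats1 !big_cat !big_seq1 /= invfM mulrC -scalerA.
by rewrite laurent_scalerAl.
Qed.

Lemma perm_compositions n : perm_eq (fset_set (compositions n.+1))
  [seq rcons k (n.+1 - j)%N | j <- iota 0 n.+1, k <- fset_set (compositions j)].
Proof.
apply: uniq_perm; first exact: fset_uniq.
  apply: allpairs_uniq_dep => [|j _|]; [exact: iota_uniq|exact: fset_uniq|].
  move=> [j k] [j' k'] /allpairsPdep[j1 [k1 [_ h1 [-> ->]]]].
  move=> /allpairsPdep[j2 [k2 [_ h2 [-> ->]]]] /= /rcons_inj [ek _].
  move: h1 h2; rewrite ek !mem_compositions => /andP[_ /eqP <-] /andP[_ /eqP <-].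
  by [].
move=> k; rewrite mem_compositions; apply/andP/allpairsPdep.
  case: (lastP k) => [[_]|s m]; first by [].
  rewrite all_rcons sumn_rcons => -[/andP[m0 sa] /eqP e].
  exists (sumn s), s; rewrite mem_iota mem_compositions sa eqxx; split=> //; first lia.
  by congr rcons; lia.
move=> [j [s [hj hs ->]]]; rewrite all_rcons sumn_rcons.
move: hj hs; rewrite mem_iota mem_compositions => hj /andP[-> /eqP ->].
by split; [rewrite andbT; lia|apply/eqP; lia].
Qed.

Lemma comp_sum0 : comp_sum 0 = 1.
Proof.
rewrite comp_sumE (perm_big [:: [::]]) /=.
  by rewrite big_seq1 /comp_weight /= !big_nil invr1 scale1r.
apply: uniq_perm => // [|k]; first exact: fset_uniq.
rewrite mem_compositions inE; case: k => [//|m k] /=.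
by apply/negbTE/negP => /andP[/andP[m0 _] /eqP]; lia.
Qed.

(** The compositions of n+1 are sorted by their last part. *)
Lemma comp_sumS n :
  comp_sum n.+1 *+ n.+1 = \sum_(j < n.+1) comp_sum j * om (n.+1 - j)%N.
Proof.
rewrite comp_sumE (perm_big _ (perm_compositions n)) big_allpairs_dep.
rewrite -[iota 0 n.+1]/(index_iota 0 n.+1) big_mkord -sumrMnl.
apply: eq_bigr => j _; rewrite comp_sumE mulr_suml -sumrMnl.
rewrite [LHS]big_seq [RHS]big_seq; apply: eq_bigr => k.
rewrite mem_compositions => /andP[_ /eqP sk].
have jn : (j <= n.+1)%N by apply/ltnW.
rewrite comp_weight_rcons ?subn_gt0 // sk subnKC // -scaler_nat scalerA.
by rewrite mulfV // scale1r.
Qed.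
End Compositions.

(** * Graded solutions of the intertwining equation *)

Section EigenIndependence.
Variable V : zmodType.
Hypothesis torsionfree : forall (v : V) n, v *+ n.+1 = 0 -> v = 0.
Variable D : {additive V -> V}.

Lemma eigen_independent n (f : nat -> V) :
  (forall k, (k < n)%N -> D (f k) = f k *~ (-2 * k%:Z)) ->
  \sum_(k < n) f k = 0 -> forall k, (k < n)%N -> f k = 0.
Proof.
elim: n f => [//|n IH] f Df sf.
(* D + 2n kills f n and multiplies the other f k by 2 (n - k) <> 0. *)
have f0 k : (k < n)%N -> f k = 0.
  move=> kn; apply: (@torsionfree _ (2 * (n - k)).-1).
  rewrite prednK ?muln_gt0 ?subn_gt0 //.
  apply: (IH (fun k => f k *+ (2 * (n - k)))) kn => [j jn|].
    by rewrite raddfMn Df 1?ltnW // !(pmulrn (f _)) (pmulrn (_ *~ _)) -!mulrzA mulrC.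
  have : D (\sum_(k < n.+1) f k) + (\sum_(k < n.+1) f k) *+ (2 * n) = 0.
    by rewrite sf raddf0 mul0rn addr0.
  rewrite raddf_sum -sumrMnl -big_split /= big_ord_recr /= Df //.
  rewrite [X in _ + X](_ : _ = 0) ?addr0 => [h|]; last first.
    by rewrite (pmulrn (f _)) -mulrzDr (_ : _ + _ = 0) ?mulr0z //; lia.
  rewrite -[RHS]h; apply: eq_bigr => j _; have := ltn_ord j => jn.
  rewrite Df; last by apply: ltn_trans jn _.
  by rewrite !(pmulrn (f _)) -mulrzDr; congr (_ *~ _); lia.
move=> k; rewrite ltnS leq_eqVlt => /predU1P[->|/f0 //].
by move: sf; rewrite big_ord_recr /= big1 ?add0r // => j _; apply: f0.
Qed.
End EigenIndependence.

Lemma intertwine_bracket (L : pzRingType) (S b R : L) :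
  R * (S - b) = S * R <-> bracket S R = - (R * b).
Proof.
rewrite /bracket mulrBr; split=> [<-|]; first by rewrite addrAC subrr add0r.
by move/(canRL (subrK _)) => ->; rewrite addrC.
Qed.

Lemma bracket_zmod (L : pzRingType) (a : L) : zmod_morphism (bracket a).
Proof. by move=> x y; rewrite bracketDr bracketN. Qed.
HB.instance Definition _ (L : pzRingType) (a : L) :=
  GRing.isZmodMorphism.Build L L (bracket a) (bracket_zmod a).

Section TriangularSeries.
Variables (K : fieldType) (A : algType K).
Local Notation T := (tensor A A).
Hypothesis natK : forall n, (n.+1%:R : K) != 0.

Lemma lmod_torsionfree (V : lmodType K) (v : V) n : v *+ n.+1 = 0 -> v = 0.
Proof.
move=> h; apply: (scalerI (natK n)).
by rewrite scaler0 scaler_nat.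
Qed.

Variables (xi0 : A) (cc b : T).
Let B : T := tens xi0 1.
Let std : laurent T := lconst cc + lmono 1 B.

Lemma bracket_wt_tens n f : wt_tens xi0 n f -> bracket B f = f *~ (-2 * n%:Z).
Proof.
move=> [s [hs ->]]; rewrite bracket_sum mulrz_suml big_seq [RHS]big_seq.
apply: eq_bigr => p /hs [h _]; rewrite /bracket !tensM mulr1 mul1r.
rewrite -[tens (p.1 * _) _]scale1r -scaleNr -tensZl -tensDl scaleN1r.
rewrite -/(bracket xi0 p.1) h.
by rewrite -!scaler_int tensZl.
Qed.

(** [is_Rminus] over an arbitrary algebra and with an arbitrary corner b. *)
Definition graded_solution (R : laurent T) := exists Rn : nat -> laurent T,
  [/\ forall n, is_powser (Rn n) /\ forall i, wt_tens xi0 n (Rn n i),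
      Rn 0 = lconst (tens 1 1), is_lsum Rn R & R * (std - lconst b) = std * R].

Lemma bracket_std_coef (f : laurent T) i :
  bracket std f (i + 1) = bracket cc (f (i + 1)) + bracket B (f i).
Proof.
rewrite /std bracketDl lcoefD bracket_lconst; congr (_ + _).
by rewrite /bracket lcoefB lmonoMl lmonoMr addrK.
Qed.

Lemma solution_coef (R : laurent T) (Rn : nat -> laurent T) i :
  is_lsum Rn R -> exists N, forall n, (N <= n)%N -> R i = \sum_(k < n) Rn k i.
Proof.
by move=> /(_ i) [N hN]; exists N => n Nn; rewrite -(hN n Nn) lcoef_sum.
Qed.

(** Downward induction on the exponent of s: the first coefficient d_i of the
    difference that could be nonzero is killed by ad (xi_0 ⊗ 1), while it is a sum
    of vectors of nonzero weights, the weight 0 parts being equal. *)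
Lemma graded_solution_unique R1 R2 :
  graded_solution R1 -> graded_solution R2 -> R1 = R2.
Proof.
move=> [F [hF F0 sF /intertwine_bracket eF]] [G [hG G0 sG /intertwine_bracket eG]].
pose d := R1 - R2; pose e i k := F k i - G k i.
have dE i : exists N, forall n, (N <= n)%N -> d i = \sum_(k < n) e i k.
  have [N1 h1] := solution_coef i sF; have [N2 h2] := solution_coef i sG.
  exists (maxn N1 N2) => n; rewrite geq_max => /andP[n1 n2].
  by rewrite lcoefB (h1 n) // (h2 n) // sumrB.
have e_wt i k : bracket B (e i k) = e i k *~ (-2 * k%:Z).
  have [_ /(_ i) hf] := hF k; have [_ /(_ i) hg] := hG k.
  by rewrite raddfB /= (bracket_wt_tens hf) (bracket_wt_tens hg) -mulrzBl.
have ed : bracket std d = - (d * lconst b).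
  by rewrite raddfB /= eF eG mulrBl opprB opprK addrC.
have d_deg m : deg_le (- m%:Z) d.
  elim: m => [|m IH] i mi.
    have [N hN] := dE i; rewrite (hN N) // big1 // => k _; rewrite /e.
    have [hf _] := hF k; have [hg _] := hG k.
    by rewrite hf ?hg ?subrr //; lia.
  have [/IH //|im] : - m%:Z < i \/ i = - m%:Z by lia.
  have Bd : bracket B (d i) = 0.
    have := congr1 (fun f : laurent T => f (i + 1)) ed.
    rewrite bracket_std_coef lcoefN lmonoMr subr0 IH; last lia.
    by rewrite bracket0 add0r mul0r oppr0.
  have [N hN] := dE i.
  (* In weight 0, where e i 0 = 0, put - d i: the sum over k then vanishes. *)
  pose f k := if k is k'.+1 then e i k else - d i.
  have f_wt k : (k < N.+1)%N -> bracket B (f k) = f k *~ (-2 * k%:Z).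
    by case: k => [_|k _] /=; rewrite ?e_wt // bracketN Bd oppr0 mulr0 mulr0z.
  have sf : \sum_(k < N.+1) f k = 0.
    have hd : d i = \sum_(k < N) e i k.+1.
      by rewrite (hN N.+1) // big_ord_recl {1}/e F0 G0 subrr add0r.
    rewrite big_ord_recl (_ : f (@ord0 N) = - d i) // hd; exact: addNr.
  have := eigen_independent (@lmod_torsionfree T) f_wt sf (ltn0Sn N).
  by move/eqP; rewrite oppr_eq0 => /eqP.
apply: (@deg_le_eq _ _ _ 0) => n; rewrite sub0r; exact: d_deg.
Qed.

Variable Rterm : nat -> laurent T.
Hypotheses (Rterm0 : Rterm 0 = 1) (Rterm_deg : forall n, deg_le (- n%:Z) (Rterm n)).
Hypothesis Rterm_wt : forall n i, wt_tens xi0 n (Rterm n i).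
Hypothesis Rterm_rec : forall n, bracket std (Rterm n.+1) = - (Rterm n * lconst b).

(** The terms with k > m have degree less than - m, so the coefficient of s^(-m)
    is a finite sum. *)
Definition Rterm_sum : laurent T :=
  lser (fun m => \sum_(k < m.+1) Rterm k (- m%:Z)).

Lemma Rterm_sum_deg n : deg_le (- n%:Z) (Rterm_sum - \sum_(k < n) Rterm k).
Proof.
move=> i ni; rewrite lcoefB lcoef_sum; have [i0|[m im]] := int_cases i.
  by rewrite lser_gt0 // big1 ?subr0 // => k _; apply: Rterm_deg; lia.
rewrite im lserN; have mn : (m.+1 <= n)%N by lia.
rewrite -(subnK mn) addnC big_split_ord /= [X in _ - (_ + X)]big1.
  by rewrite addr0 subrr.
by move=> k _; apply: Rterm_deg; lia.
Qed.

Lemma Rterm_sum_lsum : is_lsum Rterm Rterm_sum.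
Proof.
move=> i; exists (absz i).+1 => n ni; apply/eqP.
rewrite eq_sym -subr_eq0 -lcoefB; apply/eqP; apply: (@Rterm_sum_deg n); lia.
Qed.

Let std_deg : deg_le 1 std.
Proof.
apply: deg_leD; last exact: deg_le_mono.
by move=> i i1; apply: deg_le_const; lia.
Qed.

Lemma bracket_Rterm_sum : bracket std Rterm_sum = - (Rterm_sum * lconst b).
Proof.
apply: (@deg_le_eq _ _ _ 0) => n.
have eP : bracket std (\sum_(k < n.+1) Rterm k) = - ((\sum_(k < n) Rterm k) * lconst b).
  rewrite bracket_sum big_ord_recl Rterm0 bracket1 add0r mulr_suml -sumrN.
  by apply: eq_bigr => k _; rewrite Rterm_rec.
have -> : bracket std Rterm_sum - - (Rterm_sum * lconst b)
    = bracket std (Rterm_sum - \sum_(k < n.+1) Rterm k)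
      + (Rterm_sum - \sum_(k < n) Rterm k) * lconst b.
  by rewrite raddfB /= eP mulrBl !opprK [RHS]addrACA subrr addr0.
apply: deg_leD.
  rewrite /bracket; apply: deg_leB.
    by apply: deg_leW (deg_leM std_deg (@Rterm_sum_deg n.+1)); lia.
  by apply: deg_leW (deg_leM (@Rterm_sum_deg n.+1) std_deg); lia.
by apply: deg_leW (deg_leM (@Rterm_sum_deg n) (deg_le_const _)); lia.
Qed.

Lemma Rterm_sum_solution : graded_solution Rterm_sum.
Proof.
exists Rterm; split.
- by move=> n; split=> [i i0|]; [apply: Rterm_deg; lia|exact: Rterm_wt].
- by rewrite Rterm0 tens1.
- exact: Rterm_sum_lsum.
exact/intertwine_bracket/bracket_Rterm_sum.
Qed.
End TriangularSeries.

(** * The solution for the Yangian *)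

Section CompositionSeries.
Variables (K : fieldType) (A : algType K).
Variable om : nat -> laurent (tensor A A).

Lemma comp_sum_series : comp_sum om = fun n => if n is 0%N then lconst (tens 1 1)
  else \sum_(k \in compositions n)
    (\prod_(p <- scanl addn 0%N k) (p%:R : K))^-1 *: \prod_(j <- k) om j.
Proof. by apply/funext => -[|n] //; rewrite comp_sum0 tens1. Qed.

Lemma comp_series_lsum : (forall n, deg_le (- n%:Z) (comp_sum om n)) ->
  is_lsum (fun n => if n is 0%N then lconst (tens 1 1)
    else \sum_(k \in compositions n)
      (\prod_(p <- scanl addn 0%N k) (p%:R : K))^-1 *: \prod_(j <- k) om j)
    (Rterm_sum (comp_sum om)).
Proof. by rewrite -comp_sum_series; exact: Rterm_sum_lsum. Qed.
End CompositionSeries.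

Section GeneralSolution.
Variables (K : fieldType) (hbar : K) (A : algType K).
Variables (t xi0 : A) (xp xm : nat -> A).
Local Notation T := (tensor A A).
Local Notation xpc r := (- hbar *: xp r).
Local Notation xmc r := (hbar *: xm r).
Hypothesis hbar_neq0 : hbar != 0.
Hypothesis natK : forall n, (n.+1%:R : K) != 0.
Hypothesis xi0_p : forall r, bracket xi0 (hbar *: xp r) = (hbar *: xp r) *~ 2.
Hypothesis xi0_m : forall r, bracket xi0 (xmc r) = xmc r *~ (-2).
Hypothesis t_p : forall r, bracket t (xpc r) = xpc r.+1 *~ 2.
Hypothesis t_m : forall r, bracket t (xmc r) = xmc r.+1 *~ (-2).
Hypothesis x_p : forall n,
  bracket (xp 0) (xpc n.+1) = \sum_(a < n.+1) xpc a * xpc (n - a)%N.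
Hypothesis x_m : forall n,
  bracket (xm 0) (xmc n.+1) = \sum_(a < n.+1) xmc a * xmc (n - a)%N.

Local Notation om := (tensor_omega hbar xp xm).
Local Notation Rterm := (comp_sum om).

Let Rterm_scale n :
  Rterm n.+1 = (n.+1%:R : K)^-1 *: \sum_(j < n.+1) Rterm j * om (n.+1 - j)%N.
Proof.
by rewrite -(comp_sumS natK) -scaler_nat scalerA mulVf // scale1r.
Qed.

Lemma comp_sum_deg n : deg_le (- n%:Z) (Rterm n).
Proof.
elim/ltn_ind: n => -[_|n IH]; first by rewrite comp_sum0 oppr0; exact: deg_le_const.
move=> i ni; rewrite Rterm_scale lcoefZ lcoef_sum big1 ?scaler0 // => j _.
have jn : (j <= n.+1)%N by apply/ltnW.
apply: (deg_leM (IH _ (ltn_ord j)) (@tensor_omega_deg _ _ _ _ _ (n.+1 - j)%N)).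
by lia.
Qed.

Lemma comp_sum_wt n i : wt_tens xi0 n (Rterm n i).
Proof.
elim/ltn_ind: n i => -[_ i|n IH i].
  rewrite comp_sum0 /=; case: ifP => _; last exact: wt_tens0.
  by rewrite -tens1; apply: wt_tens1; rewrite bracket1 mulr0.
rewrite Rterm_scale lcoefZ; apply: wt_tensZ; rewrite lcoef_sum.
apply: wt_tens_sum => j _; apply: lcoef_mul_ind; [exact: wt_tens0|exact: wt_tensD|].
move=> k l; rewrite [X in wt_tens _ X _](_ : _ = (j + (n.+1 - j))%N).
  2: by rewrite subnKC // ltnW.
apply: wt_tensM; first exact: IH.
exact: wt_tensor_omega.
Qed.

Lemma comp_sum_solution : graded_solution xi0 (tens t 1 + tens 1 t)
  ((2 * hbar) *: tens (xm 0) (xp 0)) (Rterm_sum Rterm).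
Proof.
apply: Rterm_sum_solution.
- exact: comp_sum0.
- exact: comp_sum_deg.
- exact: comp_sum_wt.
apply: bracket_Rterm.
- move=> n f g /eqP; rewrite -subr_eq0 -mulrnBl => /eqP /(lmod_torsionfree natK).
  by move/eqP; rewrite subr_eq0 => /eqP.
- exact: comp_sum0.
- exact: comp_sumS.
- exact: bracket_omega1.
- exact: bracket_omegaSS.
Qed.
End GeneralSolution.

Section RminusYangian.
Variables (K : fieldType) (hbar : K).
Hypothesis hbar_neq0 : hbar != 0.
Hypothesis natK : forall n, (n.+1%:R : K) != 0.
Local Notation Y := (yangian hbar).

Lemma wt_tensorP n (f : tensor Y Y) :
  wt_tensor n%:Z f <-> wt_tens (yxi hbar 0) n f.
Proof.
have wl (y : Y) : ywt (- n%:Z) y <-> bracket (yxi hbar 0) y = y *~ (-2 * n%:Z).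
  by rewrite /ywt /= scaler_int mulrN mulNr.
have wr (y : Y) : ywt n%:Z y <-> bracket (yxi hbar 0) y = y *~ (2 * n%:Z).
  by rewrite /ywt /= scaler_int.
split=> -[s [hs ->]]; exists s; split=> // p /hs [h1 h2]; split.
- exact: (proj1 (wl _) h1).
- exact: (proj1 (wr _) h2).
- exact: (proj2 (wl _) h1).
exact: (proj2 (wr _) h2).
Qed.

Lemma is_RminusP R : @is_Rminus K hbar R <->
  graded_solution (yxi hbar 0) (tens (t1 hbar) 1 + tens 1 (t1 hbar))
    ((2 * hbar) *: tens (yxm hbar 0) (yxp hbar 0)) R.
Proof.
split=> -[Rn [h1 h2 h3 h4]]; exists Rn; (split; last exact: h4).
- move=> n; have [hp hw] := h1 n.
  by split=> [|i]; [exact: hp|exact: (proj1 (wt_tensorP _ _) (hw i))].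
- exact: h2.
- exact: h3.
- move=> n; have [hp hw] := h1 n.
  by split=> [|i]; [exact: hp|exact: (proj2 (wt_tensorP _ _) (hw i))].
- exact: h2.
exact: h3.
Qed.

Lemma omega_gen : omega hbar = tensor_omega hbar (yxp hbar) (yxm hbar).
Proof. by []. Qed.

Lemma yangian_solution : @is_Rminus K hbar (Rterm_sum (comp_sum (omega hbar))).
Proof.
rewrite omega_gen.
have two0 : (2 : K) != 0 by exact: natK 1.
have sc (c : K) (x : Y) n : c *: (x *~ n) = (c *: x) *~ n.
  by rewrite -!scaler_int !scalerA mulrC.
have e0 : - ((-1) ^+ false * hbar) = - hbar by rewrite expr0 mul1r.
have e1 : - ((-1) ^+ true * hbar) = hbar by rewrite expr1 mulN1r opprK.
apply/is_RminusP/comp_sum_solution => //.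
- by move=> r; rewrite bracketZr yxi0_x sc.
- by move=> r; rewrite bracketZr yxi0_x sc.
- by move=> r; rewrite bracketZr yt1_x // sc.
- by move=> r; rewrite bracketZr yt1_x // sc.
- by move=> n; exact: (yx_scaled_quadratic two0 n e0).
by move=> n; exact: (yx_scaled_quadratic two0 n e1).
Qed.

Lemma comp_sum_omega_deg n : deg_le (- n%:Z) (comp_sum (omega hbar) n).
Proof. rewrite omega_gen; exact: comp_sum_deg. Qed.

Lemma is_Rminus_unique R1 R2 :
  @is_Rminus K hbar R1 -> @is_Rminus K hbar R2 -> R1 = R2.
Proof.
by move=> /is_RminusP h1 /is_RminusP h2; apply: graded_solution_unique h1 h2.
Qed.
End RminusYangian.

Theorem theorem5p5 (R : realType) (hbar : R[i]) (hbar_neq0 : hbar != 0) :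
  exists Rm : laurent (tensor (yangian hbar) (yangian hbar)),
    unique (@is_Rminus R[i] hbar) Rm /\
    is_lsum (fun n : nat =>
      if n is 0%N then lconst (tens 1 1)
      else \sum_(k \in compositions n)
             (\prod_(p <- scanl addn 0%N k) (p%:R : R[i]))^-1 *:
               \prod_(j <- k) omega hbar j) Rm.
Proof.
have natK n : (n.+1%:R : R[i]) != 0 by rewrite pnatr_eq0.
have sol := yangian_solution hbar_neq0 natK.
exists (Rterm_sum (comp_sum (omega hbar))); split.
  split=> [|R' sol']; first exact: sol.
  exact: (is_Rminus_unique natK sol sol').
exact: (comp_series_lsum (comp_sum_omega_deg hbar_neq0 natK)).
Qed.
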